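(* For any non-amenable group $\Gamma$, the reduced crossed product of the universal minimal action of $\Gamma$ is purely infinite.
   Context: $\Gamma$ is a discrete group (possibly uncountable); compact spaces are compact Hausdorff, possibly non-metrizable; actions are by homeomorphisms. An action is minimal if there is no nonempty proper open invariant subset. The universal minimal action of $\Gamma$ is the minimal action of $\Gamma$ on a compact space $X$, unique up to conjugacy (Ellis), which factors onto every minimal action of $\Gamma$ on a compact space, i.e. for every minimal action of $\Gamma$ on a compact space $Y$ there is a $\Gamma$-equivariant continuous surjection $X\to Y$. A unital C$^\ast$-algebra $A$ is purely infinite if it is simple and for any nonzero positive element $a\in A$ there is $x\in A$ with $xax^\ast=1$. *)

(* Defs.v *)
From HB Require Import structures.
From mathcomp Require Import all_boot all_order all_algebra.
From mathcomp Require Import complex ring lra.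
From mathcomp Require Import all_classical all_reals all_analysis.
From mathcomp Require summability.

Set Implicit Arguments.
Unset Strict Implicit.
Unset Printing Implicit Defensive.
Import Order.TTheory GRing.Theory Num.Theory.
Import numFieldNormedType.Exports ComplexField.Normc.
Local Open Scope classical_set_scope.
Local Open Scope ring_scope.

(* An invariant mean is a functional on the bounded functions G -> R; the      *)
(* values of m at unbounded functions are junk and are not constrained.        *)
Section Amenability.
Variables (R : realType) (G : groupType).

Definition bounded_function (f : G -> R) : Prop :=
  exists M : R, forall g, `|f g| <= M.

Record invariant_mean (m : (G -> R) -> R) : Prop := {
  mean_linear : forall (c : R) (f h : G -> R),
    bounded_function f -> bounded_function h ->
    m (fun g => c * f g + h g) = c * m f + m h;
  mean_ge0 : forall f : G -> R,
    bounded_function f -> (forall g, 0 <= f g) -> 0 <= m f;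
  mean_cst1 : m (fun=> 1) = 1;
  mean_invariant : forall (t : G) (f : G -> R),
    bounded_function f -> m (fun g => f (t^-1 * g)%g) = m f }.

Definition amenable : Prop := exists m, invariant_mean m.

End Amenability.

Section Actions.
Variables (G : groupType) (X : topologicalType).
Implicit Types act : G -> X -> X.

(* Each [act g] is then a homeomorphism, with inverse [act g^-1]. *)
Record continuous_action act : Prop := {
  action1 : forall x, act 1%g x = x;
  actionM : forall g h x, act (g * h)%g x = act g (act h x);
  action_continuous : forall g, continuous (act g) }.

Definition minimal_action act : Prop :=
  forall U : set X, open U -> U !=set0 ->
    (forall g, act g @` U = U) -> U = [set: X].

(* The empty space has to be excluded: no nonempty space maps to it. *)
Record minimal_compact_action act : Prop := {
  mca_nonempty : [set: X] !=set0;
  mca_compact : compact [set: X];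
  mca_hausdorff : hausdorff_space X;
  mca_action : continuous_action act;
  mca_minimal : minimal_action act }.

End Actions.

Definition universal_minimal_action (G : groupType) (X : topologicalType)
    (act : G -> X -> X) : Prop :=
  minimal_compact_action act /\
  forall (Y : topologicalType) (actY : G -> Y -> Y),
    minimal_compact_action actY ->
    exists phi : X -> Y, [/\ continuous phi, set_surj [set: X] [set: Y] phi
      & forall g x, phi (act g x) = actY g (phi x)].

(* The Hilbert space l^2(I), for an arbitrary (possibly uncountable) I. The    *)
(* codomain is R[i]^o, since R[i] itself is also a module over R.              *)
Section HilbertSpace.
Variables (R : realType) (I : choiceType).

Definition l2_sum (x : I -> R[i]^o) : \bar R :=
  (\esum_(i in [set: I]) ((normc (x i)) ^+ 2)%:E)%E.

Definition square_summable : pred (I -> R[i]^o) :=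
  fun x => `[< (l2_sum x < +oo)%E >].

Let sqnormcD (a b : R[i]) : normc (a + b) ^+ 2 <=
  normc a ^+ 2 + normc a ^+ 2 + (normc b ^+ 2 + normc b ^+ 2).
Proof.
case: a b => a1 a2 [b1 b2] /=.
rewrite !sqr_sqrtr ?addr_ge0 ?sqr_ge0 //.
have := sqr_ge0 (a1 - b1); have := sqr_ge0 (a2 - b2); nra.
Qed.

Lemma l2_sum_mul (u x : I -> R[i]^o) (M : R) :
  (forall i, normc (u i) <= M) -> (l2_sum x < +oo)%E ->
  (l2_sum (fun i => (u i : R[i]) * x i)%R < +oo)%E.
Proof.
move=> uM xfin; have n0 (z : R[i]) : 0 <= normc z by case: z => *; apply: sqrtr_ge0.
suff le : (l2_sum (fun i => (u i : R[i]) * x i)%R <= (M ^+ 2)%:E * l2_sum x)%E.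
  by apply: le_lt_trans le _; rewrite lte_mul_pinfty// lee_fin sqr_ge0.
apply: ge_ereal_sup => _ [A [finA _] <-].
apply: (@le_trans _ _ (\sum_(i \in A) (M ^+ 2)%:E * (normc (x i) ^+ 2)%:E)%E).
  apply: lee_fsum => // i _.
  rewrite -EFinM lee_fin normcM exprMn ler_wpM2r ?sqr_ge0//.
  by rewrite lerXn2r ?nnegrE//; exact: le_trans (n0 _) (uM i).
rewrite -ge0_mule_fsumr; last by move=> i; rewrite lee_fin sqr_ge0.
rewrite lee_wpmul2l ?lee_fin ?sqr_ge0//.
by apply: ereal_sup_ubound; exists A.
Qed.

Fact square_summable_submod_closed : submod_closed square_summable.
Proof.
split=> [|c x y /asboolP xfin /asboolP yfin].
  apply/asboolP; rewrite /l2_sum esum1 ?ltry// => i _ /=.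
  by rewrite expr0n /= addr0 sqrtr0 expr0n.
have {xfin}cxfin : (l2_sum (c *: x) < +oo)%E.
  exact: (@l2_sum_mul (fun=> c) x (normc c)).
apply/asboolP; set z := c *: x in cxfin *.
suff le : (l2_sum (z + y)%R <= l2_sum z + l2_sum z + (l2_sum y + l2_sum y))%E.
  by apply: le_lt_trans le _; rewrite !lte_add_pinfty.
rewrite /l2_sum -!esumD; try by move=> *; rewrite ?adde_ge0 ?lee_fin ?sqr_ge0.
by apply: le_esum => i _; rewrite -!EFinD lee_fin sqnormcD.
Qed.

HB.instance Definition _ := GRing.isSubmodClosed.Build R[i] (I -> R[i]^o)
  square_summable square_summable_submod_closed.

Record l2 := MkL2 { l2_val :> I -> R[i]^o; l2_valP : l2_val \in square_summable }.

HB.instance Definition _ := [isSub for l2_val].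
HB.instance Definition _ := [Choice of l2 by <:].
HB.instance Definition _ := [SubChoice_isSubLmodule of l2 by <:].

(* [x] itself if it is square-summable, and 0 otherwise. *)
Definition to_l2 (x : I -> R[i]^o) : l2 := insubd (0 : l2) x.

Definition l2_norm (x : l2) : R := Num.sqrt (fine (l2_sum x)).

Definition l2_dot (x y : l2) : R[i]^o :=
  summability.sum (fun i => (x i : R[i]) * (y i)^*%C : R[i]^o).

End HilbertSpace.

(* Operators on H = l^2(I) are plain functions H -> H, whose pointwise linear  *)
(* structure is the library's one; every Hilbert space is of the form l^2(I).  *)
Section Operators.
Variables (R : realType) (I : choiceType).
Local Notation H := (l2 R I).

Definition bounded_operator (T : H -> H) : Prop :=
  linear T /\ exists M : R, forall x, l2_norm (T x) <= M * l2_norm x.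

Definition operator_norm (T : H -> H) : R :=
  sup [set l2_norm (T x) | x in [set x | l2_norm x <= 1]].

Definition is_adjoint (T S : H -> H) : Prop :=
  forall x y, l2_dot (T x) y = l2_dot x (S y).

Definition norm_closure (A : set (H -> H)) : set (H -> H) :=
  [set T | bounded_operator T /\
    forall e : R, 0 < e -> exists2 S, A S & operator_norm (T - S) < e].

(* In the rest of this section A is meant to be a C*-algebra of operators:     *)
(* a norm-closed *-subalgebra of the bounded operators.                        *)
Record closed_ideal (A J : set (H -> H)) : Prop := {
  ideal_sub : J `<=` A;
  ideal0 : J 0;
  idealD : forall S T, J S -> J T -> J (S + T);
  idealZ : forall (c : R[i]) T, J T -> J (c *: T);
  idealMl : forall S T, A S -> J T -> J (S \o T);
  idealMr : forall S T, J S -> A T -> J (S \o T);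
  ideal_closed : norm_closure J `<=` J }.

Definition simple_cstar (A : set (H -> H)) : Prop :=
  A <> [set 0] /\ forall J, closed_ideal A J -> J = [set 0] \/ J = A.

(* The positive elements are those of the form b^* b. *)
Definition positive_element (A : set (H -> H)) (a : H -> H) : Prop :=
  exists b bstar, [/\ A b, A bstar, is_adjoint b bstar & a = bstar \o b].

(* A is moreover meant to be unital, with unit the identity operator.          *)
Definition purely_infinite (A : set (H -> H)) : Prop :=
  simple_cstar A /\
  forall a, positive_element A a -> a <> 0 ->
    exists x xstar, [/\ A x, A xstar, is_adjoint x xstar
      & x \o a \o xstar = id].

End Operators.

(* C(X) is represented faithfully on l^2(X), X without its topology, by        *)
(* multiplication; what follows is the regular representation induced by it on *)
(* l^2(G, l^2(X)) = l^2(G * X). As (g.f)(x) = f(g^-1 x), the function f acts   *)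
(* on the fiber over s through s^-1.f, which is f o act s.                     *)
Section ReducedCrossedProduct.
Variables (R : realType) (G : groupType) (X : topologicalType).
Variable act : G -> X -> X.
Local Notation H := (l2 R (G * X)%type).

Definition crossed_fun (f : X -> R[i]^o) (xi : H) : H :=
  to_l2 (fun p => (f (act p.1 p.2) : R[i]) * xi p).

Definition crossed_unitary (t : G) (xi : H) : H :=
  to_l2 (fun p => xi ((t^-1 * p.1)%g, p.2)).

(* For continuous f on compact X, to_l2 takes its default value in neither of  *)
(* the two definitions above.                                                  *)
Lemma crossed_funE (f : X -> R[i]^o) (xi : H) p :
  compact [set: X] -> continuous f ->
  crossed_fun f xi p = (f (act p.1 p.2) : R[i]) * xi p.
Proof.
move=> cX cf.
have nE (z : R[i]) : `|z| = (normc z)%:C%C by [].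
have cnf : continuous (fun x => normc (f x)).
  move=> x; apply/cvgrPdist_lt => e e0.
  have e0' : 0 < e%:C%C by rewrite ltcR.
  have /cvgrPdist_lt /(_ _ e0') := cf x.
  apply: filterS => y; rewrite nE ltcR => fxy.
  apply: le_lt_trans fxy; exact: (ler_dist_dist (f x : Rcomplex R) (f y)).
have [M [_ fM]] : bounded_set (range (fun x => normc (f x))).
  apply: compact_bounded; apply: continuous_compact cX.
  exact: continuous_subspaceT.
rewrite /crossed_fun /to_l2 insubdK//; apply/asboolP.
apply: (@l2_sum_mul _ _ (fun p => f (act p.1 p.2)) _ (M + 1)).
  move=> q; apply: le_trans (ler_norm _) (fM _ _ _ _); first by rewrite ltrDl.
  by exists (act q.1 q.2).
by have /asboolP := l2_valP xi.
Qed.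

Lemma crossed_unitaryE (t : G) (xi : H) p :
  crossed_unitary t xi p = xi ((t^-1 * p.1)%g, p.2).
Proof.
rewrite /crossed_unitary /to_l2 insubdK//; apply/asboolP.
have /asboolP := l2_valP xi; rewrite /l2_sum.
rewrite (reindex_esum [set: G * X] [set: G * X] (fun q => ((t^-1 * q.1)%g, q.2)))//.
split=> [q _ //|[g x] [h y] _ _ /= [gh ->]|[g x] _ /=].
  by rewrite (mulgI _ _ _ gh).
by exists ((t * g)%g, x); rewrite //= mulKg.
Qed.

(* The image of C_c(G, C(X)): the finite sums of the f_t u_t.                  *)
Definition algebraic_crossed_product : set (H -> H) :=
  [set T | exists (F : seq G) (f : G -> X -> R[i]^o),
    (forall t, continuous (f t)) /\
    T = \sum_(t <- F) (crossed_fun (f t) \o crossed_unitary t)].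

Definition reduced_crossed_product : set (H -> H) :=
  norm_closure algebraic_crossed_product.

End ReducedCrossedProduct.

(* Main.v *)
Require Import Defs.
From mathcomp Require Import all_boot all_order all_algebra.
From mathcomp Require Import complex ring lra finmap zify.
From mathcomp Require Import all_classical all_reals all_analysis.
From mathcomp Require summability.

(** Two properties of the universal minimal action of a non-amenable group G
    on X carry the proof. The action is free, and it has comparison: for every
    nonempty open U, the space X can be cut into finitely many clopen pieces
    which suitable elements of G move to pairwise disjoint subsets of U.

    Both come from combinatorics on G. Fix x0 in X. A colouring of G by
    finitely many colours is a point of the shift G -> nat; a minimal subset Z
    of the orbit closure of (x0, colouring) in the product of X with that
    shift is again a minimal compact action, so universality gives an
    equivariant map from X to Z. Composed with the projection of Z to X it is
    an endomorphism of X, and endomorphisms of a universal minimal action are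
    bijective (universal_coalescent; the proof is Ellis's, in a minimal left
    ideal of the closure of G in X -> X, on which right multiplications are
    injective because it contains idempotents). So the colouring becomes a
    clopen partition of X whose finite patterns are patterns of the colouring
    along the orbit of x0 (orbit_labelling). A 3-colouring of the graph
    joining g to t g gives freeness. For comparison, the return times of x0 to
    a nonempty open set are syndetic. In a non-amenable group some finite set
    E expands all finite sets by any prescribed factor, for otherwise averages
    over Folner sets would converge along an ultrafilter to an invariant mean;
    Hall's theorem then moves G injectively into any syndetic set by
    finitely many left translations (syndetic_injection), and the choice of
    the translation is the colouring to use (universal_comparison).

    On the operator side, the diagonal coefficient of an element a of the
    crossed product at a basis vector (s, y) is the value at s y of the conditional
    expectation of a. Approximate a by a finite sum of terms f_t u_t and take
    U, around s y, so small that f_1 is almost constant on U and that U is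
    disjoint from its translates by the other t. The pieces of X moved into U
    define an isometry v in the algebra whose range projection is supported in
    U, so v^* a v is close to the scalar <a delta, delta> (compression). If
    a = b^* b is nonzero, this scalar is positive for some basis vector; an
    self-adjoint element close to 1 is y^-2 for some self-adjoint y (inverse_square_root,
    a fixed point of a contraction), and x = y v^*, suitably scaled, satisfies
    x a x^* = 1. If b is a nonzero element of a closed ideal, compressing
    b_0^* b with b_0 algebraic and close to b puts an element close to 1,
    hence 1 itself, in the ideal. *)

Set Implicit Arguments.
Unset Strict Implicit.
Unset Printing Implicit Defensive.
Import Order.TTheory GRing.Theory Num.Theory.
Import numFieldNormedType.Exports ComplexField.Normc.
Local Open Scope classical_set_scope.
Local Open Scope ring_scope.

(** * Hall's marriage theorem for infinite families *)

Section Hall.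
Variables (I T : choiceType).
Implicit Types (B : I -> {fset T}) (S : {fset I}).
Local Open Scope fset_scope.
Local Open Scope nat_scope.

Definition hall_condition B := forall S, #|` S| <= #|` \bigcup_(i <- S) B i|.

(** Rado's argument removes elements from the A i as long as the condition
    survives. Zorn's lemma applies because each A i is finite: the condition on
    a finite set of indices only sees finitely many removals, hence one member
    of a chain of sets of removed pairs. *)
Lemma hall_tight_family (A : I -> {fset T}) : hall_condition A ->
  exists B, [/\ hall_condition B, forall i, B i `<=` A i
    & forall i x, x \in B i -> ~ hall_condition (fun j => if j == i then B j `\ x else B j)].
Proof.
move=> hallA.
pose B (D : set (I * T)) i := [fset x in A i | ~~ `[< D (i, x) >]].
have BE D i x : (x \in B D i) = (x \in A i) && ~~ `[< D (i, x) >].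
  by rewrite !inE.
(* Finitely many removed pairs all belong to a single member of a chain. *)
have chain (F : set (set (I * T))) : F !=set0 -> total_on F subset ->
    forall s : seq (I * T), exists2 D, F D &
      forall p, p \in s -> (\bigcup_(X in F) X)%classic p -> D p.
  move=> [D0 FD0] Ftot; elim=> [|p s [D FD Ds]]; first by exists D0.
  have [[D1 FD1 D1p]|np] := pselect ((\bigcup_(X in F) X)%classic p); last first.
    by exists D => // q; rewrite inE => /predU1P[->|/Ds//]; move=> /np.
  have [DD1|D1D] := Ftot _ _ FD FD1.
    exists D1 => // q; rewrite inE => /predU1P[->//|qs] Fq; exact/DD1/Ds.
  exists D => // q; rewrite inE => /predU1P[->//|qs] Fq; [exact: D1D|exact: Ds].
have [|D [PD maxD]] := @Zorn_bigcup _ (fun D => hall_condition (B D)).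
  move=> F FP Ftot S.
  have [F0|F0] := pselect (F !=set0); last first.
    suff -> : \bigcup_(i <- S) B (\bigcup_(X in F) X)%classic i =
              \bigcup_(i <- S) A i by exact: hallA.
    apply: eq_bigr => i _; apply/fsetP => x; rewrite BE andbC.
    by case: asboolP => //= -[X FX]; case: F0; exists X.
  have [D FD Ds] := chain F F0 Ftot [seq (i, x) | i <- S, x <- A i].
  suff -> : \bigcup_(i <- S) B (\bigcup_(X in F) X)%classic i =
              \bigcup_(i <- S) B D i by exact: FP.
  apply: eq_big_seq => i iS; apply/fsetP => x; rewrite !BE.
  case: (boolP (x \in A i)) => //= xA; congr (~~ _); apply/asbool_equiv_eq.
  split=> [h|Dx]; last by exists D.
  by apply: Ds => //; apply/allpairsPdep; exists i, x.
exists (B D); split=> // [i|i x].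
  by apply/fsubsetP => x; rewrite BE => /andP[].
rewrite BE => /andP[xA /asboolP nDx] hallB'.
apply: (maxD (D `|` [set (i, x)])%classic).
  split; first by move=> p; left.
  by move=> sub; apply/nDx/sub; right.
move=> S; apply: leq_trans (hallB' S) (eq_leq _); congr (size (enum_fset _)).
apply: eq_bigr => j _; apply/fsetP => y.
have -> : (y \in B (D `|` [set (i, x)])%classic j) =
   (y \in B D j) && ((j, y) != (i, x)).
  rewrite !BE -andbA -negb_or; congr (_ && ~~ _); apply/asboolP/orP.
    by case=> [?|/eqP]; [left; apply/asboolP|right].
  by case=> [/asboolP|/eqP]; [left|right].
by case: (eqVneq j i) => [->|ji]; rewrite ?in_fsetD1 xpair_eqE ?eqxx ?(negPf ji) ?andbT //= andbC.
Qed.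

(** In a tight subfamily every B i is a singleton. If x and y are distinct in
    B i, deleting either one breaks the condition on some finite sets of indices
    S and S'; counting the union and the intersection of the two deficient sets
    then contradicts the condition on i |` (S `|` S') and on S `&` S'. *)
Lemma hall_marriage (A : I -> {fset T}) : hall_condition A ->
  exists2 f : I -> T, injective f & forall i, f i \in A i.
Proof.
move=> /hall_tight_family[B [hallB BA minB]].
have viol i x : x \in B i -> exists2 S : {fset I}, i \notin S &
    #|` \bigcup_(j <- S) B j `|` (B i `\ x)| <= #|` S|.
  move=> /(minB i x) /existsNP[S] /negP; rewrite -ltnNge => lt.
  have iS : i \in S.
    apply: contraLR lt => iS; rewrite -leqNgt; apply: leq_trans (hallB S) _.
    rewrite [X in _ <= #|` X|](_ : _ = \bigcup_(j <- S) B j) //.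
    by apply: eq_big_seq => j jS; case: eqP => // ji; rewrite -ji jS in iS.
  exists (S `\ i); first by rewrite in_fsetD1 eqxx.
  move: lt; rewrite (big_fsetD1 i) //= eqxx (cardfsD1 i S) iS add1n ltnS fsetUC.
  rewrite (_ : \bigcup_(_ <- S `\ i) _ = \bigcup_(j <- S `\ i) B j) //.
  by apply: eq_big_seq => j; rewrite in_fsetD1 => /andP[/negPf-> _].
have bigU S S' : \bigcup_(j <- S `|` S') B j =
    \bigcup_(j <- S) B j `|` \bigcup_(j <- S') B j.
  apply/fsetP => x; rewrite in_fsetU; apply/bigfcupP/orP.
    by move=> [j]; rewrite andbT in_fsetU => /orP[] jS xj; [left|right];
      apply/bigfcupP; exists j; rewrite ?jS.
  by case=> /bigfcupP[j]; rewrite andbT => jS xj; exists j;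
    rewrite // in_fsetU jS ?orbT.
have big1 i : \bigcup_(j <- [fset i]) B j = B i by rewrite big_seq_fset1.
have single i x y : x \in B i -> y \in B i -> x = y.
  move=> xB yB; apply/eqP/negPn/negP => xy.
  have [S iS leS] := viol i x xB; have [S' iS' leS'] := viol i y yB.
  set P := _ `|` _ in leS; set Q := _ `|` _ in leS'.
  have := cardfsUI P Q.
  have leU : #|` i |` (S `|` S')| <= #|` P `|` Q|.
    apply: leq_trans (hallB _) _; rewrite !bigU big1; apply/fsubset_leq_card.
    apply/fsubsetP => z; rewrite /P /Q !inE => /or3P[zi|->|->]; rewrite ?orbT //.
    by rewrite zi; case: (eqVneq z x) => [->|]; rewrite ?xy /= ?orbT.
  have leI : #|` S `&` S'| <= #|` P `&` Q|.
    apply: leq_trans (hallB _) _; apply/fsubset_leq_card.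
    apply/fsubsetP => z /bigfcupP[j]; rewrite andbT => /fsetIP[jS jS'] zj.
    apply/fsetIP; split; rewrite in_fsetU; apply/orP; left; apply/bigfcupP.
      by exists j; rewrite ?jS.
    by exists j; rewrite ?jS'.
  rewrite cardfsU1 !inE negb_or iS iS' add1n in leU.
  have := cardfsUI S S'; move: leS leS' leU leI.
  by move: #|` _| #|` _| #|` _| #|` _| #|` _| #|` _| #|` _| #|`_| => *; lia.
have inh i : exists x, x \in B i.
  have := hallB [fset i]; rewrite big1 cardfs1 => /[!cardfs_gt0].
  by move=> /fset0Pn.
have [f fB] := choice inh.
exists f => [i j fij|i]; last exact: (fsubsetP (BA i)).
apply/eqP/negPn/negP => ij.
have := hallB [fset i; j]; rewrite bigU !big1 cardfs2 ij.
suff -> : B i `|` B j = [fset f i] by rewrite cardfs1.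
apply/fsetP => x; rewrite !inE; apply/orP/eqP => [[xB|xB]|->]; last by left.
  exact: single (xB) (fB i).
by rewrite fij; exact: single (xB) (fB j).
Qed.

End Hall.

(** * Amenability and the growth of finite sets *)

(** Compactness of segments, in the form that makes limits of averages exist. *)
Lemma bounded_ultra_cvg (R : realType) (I : Type) (U : set_system I)
    (u : I -> R) (M : R) :
  UltraFilter U -> (forall i, `|u i| <= M) -> cvg (u @ U).
Proof.
move=> UU uM; pose F := u @ U.
have [|p [_ clp]] := @segment_compact R (- M) M F _.
  rewrite /F; change (U (u @^-1` [set` `[- M, M]])).
  by apply: filterE => i /=; rewrite in_itv /= -ler_norml.
apply/cvg_ex; exists p => V Vp.
have [//|nV] := in_ultra_setVsetC (u @^-1` V) UU.
by have [q []] := clp (~` V) V nV Vp.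
Qed.

Section Folner.
Variables (R : realType) (G : groupType).
Local Open Scope fset_scope.
Implicit Types (A E : {fset G}) (f : G -> R).

Definition fset_mul E A : {fset G} := [fset (e * a)%g | e in E, a in A].

Lemma fset_mulP E A g :
  reflect (exists e a, [/\ e \in E, a \in A & g = (e * a)%g]) (g \in fset_mul E A).
Proof.
apply: (iffP idP) => [/imfset2P[e /= eE [a /= aA ->]]|[e [a [eE aA ->]]]].
  by exists e, a.
by apply/imfset2P; exists e => //; exists a.
Qed.

Definition average A f : R := (\sum_(g <- A) f g) / #|` A|%:R.

(** The sums over A and t^-1 A differ by sums over t^-1 A minus A and A minus
    t^-1 A, two sets of the same size, at most |A| / n by the Folner condition. *)
Lemma average_translate A f (t : G) (n : nat) (M : R) :
  (0 < n)%N -> (n * #|` fset_mul [fset 1%g; t^-1%g] A| < n.+1 * #|` A|)%N ->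
  (forall g, `|f g| <= M) ->
  `|average A (fun g => f (t^-1 * g)%g) - average A f| <= 2 * M / n%:R.
Proof.
move=> n0 folner fM.
have M0 : 0 <= M by exact: le_trans (fM 1%g).
have A0 : (0 < #|` A|)%N.
  by rewrite lt0n; apply: contraTneq folner => ->; rewrite muln0 ltn0.
pose tA := [fset (t^-1 * g)%g | g in A].
have inj : {in A &, injective (fun g => t^-1 * g)%g} by move=> g h _ _; exact: mulgI.
have card_tA : #|` tA| = #|` A| by exact: card_in_imfset.
have cardU : #|` tA `|` A| = (#|` A| + #|` tA `\` A|)%N.
  rewrite -(cardfsID A (tA `|` A)) (fsetIidPr (fsubsetUr _ _)).
  by rewrite fsetDUl fsetDv fsetU0.
have cardC : #|` A `\` tA| = #|` tA `\` A|.
  apply: (@addnI #|` A `&` tA|); rewrite cardfsID.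
  by rewrite fsetIC cardfsID card_tA.
have small (B : {fset G}) : #|` B| = #|` tA `\` A| -> (n * #|` B| <= #|` A|)%N.
  move=> ->; move: folner; rewrite (_ : fset_mul _ _ = tA `|` A).
    by rewrite cardU; move: (#|` A|) (#|` tA `\` A|) => a b; nia.
  apply/fsetP => g; rewrite in_fsetU; apply/fset_mulP/orP.
    move=> [e [a [+ aA ->]]]; rewrite in_fset2 => /orP[]/eqP->.
      by rewrite mul1g; right.
    by left; apply/imfsetP; exists a.
  case=> [/imfsetP[a /= aA ->]|gA].
    by exists t^-1%g, a; rewrite in_fset2 eqxx orbT.
  by exists 1%g, g; rewrite in_fset2 eqxx mul1g.
have sumt : \sum_(g <- A) f (t^-1 * g)%g = \sum_(g <- tA) f g.
  by rewrite big_imfset.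
have bound (B : {fset G}) : (n * #|` B| <= #|` A|)%N ->
    `|\sum_(g <- B) f g| <= M * #|` A|%:R / n%:R.
  move=> nB; apply: (@le_trans _ _ (M * #|` B|%:R)).
    apply: le_trans (ler_norm_sum _ _ _) _.
    apply: le_trans (ler_sum _ (fun g _ => fM g)) _.
    by rewrite big_const_seq count_predT iter_addr addr0 mulr_natr.
  by rewrite -mulrA ler_wpM2l// ler_pdivlMr ?ltr0n// -natrM ler_nat mulnC.
rewrite /average sumt -mulrBl normrM normfV normr_nat.
rewrite ler_pdivrMr ?ltr0n//.
have split (B C : {fset G}) : \sum_(g <- B) f g =
    (\sum_(g <- B `&` C) f g + \sum_(g <- B `\` C) f g)%R.
  rewrite (big_fsetID _ (mem C)) /=; congr (_ + _)%R; apply: eq_fbigl => g;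
  by rewrite !inE // andbC.
rewrite (split tA A) (split A tA) fsetIC opprD addrACA subrr add0r.
apply: le_trans (ler_normB _ _) _.
have := bound _ (small _ erefl); have /small/bound := cardC; nra.
Qed.

Lemma average_bound A f (M : R) : (forall g, `|f g| <= M) -> `|average A f| <= M.
Proof.
move=> fM; have M0 : 0 <= M by exact: le_trans (fM 1%g).
rewrite /average normrM normfV normr_nat.
have [->|A0] := eqVneq #|` A| 0; first by rewrite invr0 mulr0.
rewrite ler_pdivrMr ?ltr0n ?lt0n//.
apply: le_trans (ler_norm_sum _ _ _) _.
apply: le_trans (ler_sum _ (fun g _ => fM g)) _.
by rewrite big_const_seq count_predT iter_addr addr0 mulr_natr.
Qed.

(** The mean is the limit of the averages over the Folner sets, along an
    ultrafilter finer than the filter of large pairs (set to be almost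
    preserved, precision). *)
Lemma folner_amenable :
  (forall E n, exists A, (n * #|` fset_mul E A| < n.+1 * #|` A|)%N) ->
  amenable R G.
Proof.
move=> folner.
(* With 1 added to the set, E A contains A and the translates of A. *)
have [A AP] := choice (fun i : {fset G} * nat => folner (1%g |` i.1) i.2).
pose F : set_system ({fset G} * nat) := filter_from setT
  (fun j => [set i | (j.1 `<=` i.1)%fset && (j.2 <= i.2)%N]%classic).
have FF : ProperFilter F.
  apply: filter_from_proper; last by move=> i _; exists i => /=; rewrite fsubset_refl leqnn.
  apply: filter_fromT_filter; first by exists (fset0, 0).
  move=> [E m] [E' m']; exists (E `|` E', maxn m m') => -[E'' m''] /=.
  by rewrite fsubUset geq_max => /andP[/andP[-> ->] /andP[-> ->]].
have [U [UU FU]] := ultraFilterLemma FF.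
pose avg f i := average (A i) f; pose m f := lim (avg f @ U).
have cvm f : bounded_function f -> avg f @ U --> m f.
  by move=> [M fM]; apply: (@bounded_ultra_cvg _ _ _ _ M) => i; exact: average_bound.
exists m; split.
- move=> c f h bf bh; apply/cvg_lim => //.
  have -> : avg (fun g => (c * f g + h g)%R) = (fun i => (c * avg f i + avg h i)%R).
    apply/funext => i; rewrite /avg /average big_split/= -mulr_sumr.
    by rewrite mulrDl mulrA.
  by apply: cvgD (cvm _ bh); apply: cvgMr; exact: cvm.
- move=> f bf f0; apply: limr_ge; first exact: cvm.
  apply: nearW => i; rewrite /avg /average mulr_ge0 ?invr_ge0//.
  by apply: sumr_ge0.
- apply/cvg_lim => //; rewrite (_ : avg _ = fun=> 1); first exact: cvg_cst.
  apply/funext => i; rewrite /avg /average big_const_seq count_predT iter_addr addr0.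
  rewrite divff// pnatr_eq0; apply: contraTneq (AP i) => ->.
  by rewrite muln0 ltn0.
move=> t f [M fM].
have bt : bounded_function (fun g => f (t^-1 * g)%g) by exists M.
have bf : bounded_function f by exists M.
apply/eqP; rewrite -subr_eq0; apply/eqP.
have /cvg_lim <- // : (avg (fun g => f (t^-1 * g)%g) \- avg f) @ U -->
    (m (fun g => f (t^-1 * g)%g) - m f)%R by apply: cvgB; exact: cvm.
apply/cvg_lim => //.
apply/cvgrPdist_le => e e0; apply: FU.
exists ([fset t^-1%g], (Num.trunc (2 * M / e)).+1) => // i /=.
rewrite fsub1set => /andP[ti ni]; rewrite sub0r normrN.
have i0 : (0 < i.2)%N by exact: leq_trans ni.
apply: le_trans (average_translate i0 _ fM) _.
  apply: leq_ltn_trans (AP i); rewrite leq_mul2l; apply/orP; right.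
  apply/fsubset_leq_card/fsubsetP => g /fset_mulP[u [a [+ aA ->]]].
  rewrite in_fset2 => uE; apply/fset_mulP; exists u, a; split=> //.
  by move: uE => /orP[]/eqP->; rewrite !inE ?eqxx ?ti ?orbT.
rewrite ler_pdivrMr ?ltr0n// [e * _]mulrC -ler_pdivrMr//.
apply: le_trans (ltW (truncnS_gt _)) _; by rewrite ler_nat.
Qed.

Lemma nonamenable_expansion : ~ amenable R G ->
  exists n E, forall A, (n.+1 * #|` A| <= n * #|` fset_mul E A|)%N.
Proof.
move=> namen; apply: contrapT => nexp; apply/namen/folner_amenable => E n.
apply: contrapT => nA; apply: nexp; exists n, E => A.
by rewrite leqNgt; apply/negP => lt; apply: nA; exists A.
Qed.

Lemma fset_mulA E E' A : fset_mul (fset_mul E E') A = fset_mul E (fset_mul E' A).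
Proof.
apply/fsetP => g; apply/fset_mulP/fset_mulP.
  move=> [_ [a [/fset_mulP[e [e' [eE eE' ->]]] aA ->]]].
  exists e, (e' * a)%g; rewrite eE mulgA; split=> //.
  by apply/fset_mulP; exists e', a.
move=> [e [_ [eE /fset_mulP[e' [a [eE' aA ->]]] ->]]].
exists (e * e')%g, a; rewrite aA mulgA; split=> //.
by apply/fset_mulP; exists e, e'.
Qed.

Lemma fset_mul1 A : fset_mul [fset 1%g] A = A.
Proof.
apply/fsetP => g; apply/fset_mulP/idP => [[e [a [/fset1P-> aA ->]]]|gA].
  by rewrite mul1g.
by exists 1%g, g; rewrite fset11 mul1g.
Qed.

(** Iterate the expansion by a factor (n + 1) / n; Bernoulli's inequality
    shows that N n iterations multiply the size by at least N. *)
Lemma nonamenable_large_expansion (N : nat) : ~ amenable R G ->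
  exists E, forall A, (N * #|` A| <= #|` fset_mul E A|)%N.
Proof.
move=> /nonamenable_expansion[n [E expE]].
have n0 : (0 < n)%N.
  by rewrite lt0n; apply/eqP => n0; move: (expE [fset 1%g]); rewrite n0 cardfs1.
have [k leN] : exists k, (N * n ^ k <= n.+1 ^ k)%N.
  exists (N * n)%N; case: N => [//|M].
  have bernoulli m : (n ^ m + m * n ^ m.-1 <= n.+1 ^ m)%N.
    elim: m => [//|[|m] IHm]; first by rewrite !expn1 mul1n expn0 addn1.
    rewrite expnS (expnS n.+1); move: IHm; rewrite /= [(n ^ m.+1)%N]expnS.
    by move: (n ^ m)%N (n.+1 ^ m.+1)%N => a b; nia.
  apply: leq_trans (bernoulli _); apply: leq_trans (leq_addl _ _).
  by rewrite -mulnA -expnS prednK// muln_gt0.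
have expk j A : (n.+1 ^ j * #|` A| <= n ^ j * #|` fset_mul (iter j (fset_mul E) [fset 1%g]) A|)%N.
  elim: j => [|j IH]; first by rewrite /= fset_mul1 !expn0 !mul1n.
  rewrite iterS fset_mulA !expnS -mulnA.
  apply: leq_trans (leq_mul (leqnn n.+1) IH) _.
  by rewrite mulnCA [(n * _)%N in X in (_ <= X)%N]mulnC -mulnA leq_mul2l expE orbT.
exists (iter k (fset_mul E) [fset 1%g]) => A.
rewrite -(@leq_pmul2l (n ^ k)) ?expn_gt0 ?n0//.
by apply: leq_trans (expk k A); rewrite mulnA leq_mul2r mulnC leN orbT.
Qed.

(** The hypothesis says that G is the union of the translates k S for k in K.
    If E multiplies the size of finite sets by |K|, then one of these |K|
    translates of S carries enough of E A: the finite sets K^-1 E g, cut down to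
    S, satisfy Hall's condition. *)
Lemma syndetic_injection (S : set G) (K : {fset G}) : ~ amenable R G ->
  (forall g, exists2 k, k \in K & S (k^-1 * g)%g) ->
  exists (E : {fset G}) (h : G -> G), [/\ forall g, h g \in E,
    forall g, S (h g * g)%g & injective (fun g => (h g * g)%g)].
Proof.
move=> namen synd.
have [E expE] := nonamenable_large_expansion #|` K| namen.
pose Ki := [fset (k^-1)%g | k in K]; pose E' := fset_mul Ki E.
pose B g := [fset x in fset_mul E' [fset g] | `[< S x >]].
have BP g x : reflect (exists2 e, e \in E' & x = (e * g)%g /\ S x) (x \in B g).
  rewrite !inE; apply: (iffP andP) => [[/fset_mulP[e [_ [eE /fset1P-> ->]]] /asboolP Sx]|].
    by exists e.
  move=> [e eE [-> /asboolP ->]]; split=> //.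
  by apply/fset_mulP; exists e, g; rewrite fset11.
have K0 : (0 < #|` K|)%N.
  by have [k kK _] := synd 1%g; rewrite cardfs_gt0; apply/fset0Pn; exists k.
have [|f finj fB] := @hall_marriage G G B.
  move=> A; rewrite -(leq_pmul2l K0); apply: leq_trans (expE A) _.
  set U := \bigcup_(g <- A) B g.
  apply: (@leq_trans #|` fset_mul K U|).
    apply/fsubset_leq_card/fsubsetP => x /fset_mulP[e [a [eE aA ->]]].
    have [k kK Sk] := synd (e * a)%g.
    apply/fset_mulP; exists k, (k^-1 * (e * a))%g; rewrite mulVKg; split=> //.
    apply/bigfcupP; exists a; first by rewrite aA.
    apply/BP; exists (k^-1 * e)%g; last by split; rewrite ?mulgA // -mulgA.
    apply/fset_mulP; exists k^-1%g, e; split=> //.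
    by apply/imfsetP; exists k.
  rewrite -(size_allpairs (fun k x => (k * x)%g)); apply: uniq_leq_size => //.
  move=> x /fset_mulP[k [y [kK yU ->]]]; exact: allpairs_f.
have translator g : exists e, [/\ e \in E', f g = (e * g)%g & S (f g)].
  by have /BP[e eE [fE Sf]] := fB g; exists e.
have [e eP] := choice translator.
exists E', e; split=> g; first by have [] := eP g.
  by have [_ <-] := eP g.
move=> h /=; have [_ <- _] := eP g; have [_ <- _] := eP h; exact: finj.
Qed.

End Folner.

(** * Minimal closed sets and minimal actions *)

Section ClosedSets.
Context {T : topologicalType}.
Implicit Types A B : set T.

Lemma chain_bigcap_nonempty (K : set T) (F : set (set T)) :
  compact K -> F !=set0 -> total_on F subset ->
  (forall A, F A -> [/\ closed A, A !=set0 & A `<=` K]) ->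
  \bigcap_(A in F) A !=set0.
Proof.
move=> cK [A0 FA0] totF FP.
pose FF := filter_from F id.
have FFp : ProperFilter FF.
  apply: filter_from_proper; last by move=> A /FP[].
  apply: filter_from_filter; first by exists A0.
  move=> A B FA FB; have [AB|BA] := totF _ _ FA FB.
    by exists A => // x Ax; split=> //; exact: AB.
  by exists B => // x Bx; split=> //; exact: BA.
have [|p [_ clp]] := cK FF FFp; first by exists A0 => //; have [] := FP _ FA0.
exists p => A FA; have [clA _ _] := FP _ FA.
by apply: clA => V Vp; apply: clp => //; exists A.
Qed.

(** Zorn's lemma for decreasing chains, applied to the complements in A0; the
    closure condition on Q is only asked for nonempty chains, so that it can
    include being nonempty. *)
Lemma minimal_closed_set (Q : set T -> Prop) (A0 : set T) :
  Q A0 ->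
  (forall F : set (set T), F !=set0 -> total_on F subset ->
     (forall A, F A -> Q A /\ A `<=` A0) -> Q (\bigcap_(A in F) A)) ->
  exists A, [/\ Q A, A `<=` A0 & forall B, Q B -> B `<=` A -> B = A].
Proof.
move=> QA0 Qchain.
have [|C [QC maxC]] := @Zorn_bigcup T (fun C => Q (A0 `\` C)).
  move=> F FQ totF; have [F0|F0] := pselect (F !=set0); last first.
    rewrite (_ : \bigcup_(X in F) X = set0) ?setD0//.
    by rewrite -subset0 => x [X FX]; case: F0; exists X.
  rewrite (_ : _ `\` _ = \bigcap_(A in [set A0 `\` C | C in F]) A).
    apply: Qchain.
    - by case: F0 => C FC; exists (A0 `\` C); exists C.
    - move=> _ _ [C FC <-] [D FD <-]; have [CD|DC] := totF _ _ FC FD.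
        by right; apply: setDS.
      by left; apply: setDS.
    - by move=> _ [C FC <-]; split; [exact: FQ|exact: subDsetl].
  case: F0 => C0 FC0; apply/seteqP; split=> [x [A0x nx] _ [C FC <-]|x h].
    by split=> // Cx; apply: nx; exists C.
  split; first by have [] := h _ (ex_intro2 _ _ C0 FC0 erefl).
  by move=> [C FC Cx]; have [_] := h _ (ex_intro2 _ _ C FC erefl).
exists (A0 `\` C); split=> //.
move=> B QB BA; have BE : A0 `\` (C `|` (A0 `\` B)) = B.
  apply/seteqP; split=> [x [A0x /not_orP[_ nx]]|x Bx].
    by apply: contrapT => nB; apply: nx; split.
  have [A0x nCx] := BA _ Bx; split=> // -[//|[]//].
apply/seteqP; split=> // x [A0x nCx]; apply: contrapT => nBx.
apply: (maxC (C `|` (A0 `\` B))); last by rewrite BE.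
by split=> [y|sub]; [left|apply/nCx/sub; right].
Qed.

End ClosedSets.

Lemma ptws_continuous (S : topologicalType) (I : Type) (T : topologicalType)
    (f : S -> {ptws I -> T}) :
  (forall i, continuous (fun s => f s i)) -> continuous f.
Proof.
move=> cf x; apply/cvg_sup.
move=> i; move: x; apply/(@continuousP _ (initial_topology (@^~ i))) => A [B oB <-].
exact: (open_comp (fun s _ => cf i s) oB).
Qed.

Lemma ptws_eval_continuous (I : choiceType) (T : topologicalType) (i : I) :
  continuous (fun f : {ptws I -> T} => f i).
Proof. exact: (@proj_continuous I (fun=> T) i). Qed.

Lemma closed_equalizer (S T : topologicalType) (f g : S -> T) :
  hausdorff_space T -> continuous f -> continuous g -> closed [set x | f x = g x].
Proof.
move=> hT cf cg x clx; apply: hT => A B Afx Bgx.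
have [|y [/= fg [Afy Bgy]]] := clx ((f @^-1` A) `&` (g @^-1` B)).
  by apply: filterI; [exact: cf|exact: cg].
by exists (f y); split=> //; rewrite fg.
Qed.

Section MinimalSets.
Context {G : groupType} {T : topologicalType} (act : G -> T -> T).
Implicit Types (A B M : set T).

Definition invariant_set A : Prop := forall g x, A x -> A (act g x).

Record minimal_set M : Prop := {
  minimal_closed : closed M;
  minimal_nonempty : M !=set0;
  minimal_invariant : invariant_set M;
  minimal_least : forall A, closed A -> A !=set0 -> invariant_set A ->
    A `<=` M -> A = M }.

Lemma exists_minimal_set A : compact A -> closed A -> A !=set0 ->
  invariant_set A -> exists2 M, minimal_set M & M `<=` A.
Proof.
move=> cA clA A0 invA.
have [||M [[clM M0 invM] MA minM]] :=
  @minimal_closed_set T (fun B => [/\ closed B, B !=set0 & invariant_set B]) A.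
- by [].
- move=> F F0 totF FQ; split.
  + by apply: closed_bigI => B /FQ[[]].
  + by apply: (chain_bigcap_nonempty cA) => // B /FQ[[]].
  + by move=> g x Fx B FB; have [[_ _ invB] _] := FQ _ FB; exact: invB (Fx _ FB).
by exists M => //; split=> // B clB B0 invB BM; exact: minM.
Qed.

Hypothesis contact : continuous_action act.

Lemma actK g : cancel (act g) (act g^-1%g).
Proof. by move=> x; rewrite -(actionM contact) mulVg (action1 contact). Qed.

Lemma actVK g : cancel (act g^-1%g) (act g).
Proof. by move=> x; rewrite -(actionM contact) mulgV (action1 contact). Qed.

Lemma closure_orbit_invariant x : invariant_set (closure (range (act^~ x))).
Proof.
move=> g y cly V Vgy.
have [_ [[h _ <-] Vh]] := cly _ (action_continuous contact Vgy).
by exists (act g (act h x)); split=> //; exists (g * h)%g => //; rewrite (actionM contact).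
Qed.

Section Restriction.
Variables (M : set T) (invM : invariant_set M).

Definition restrict_act (g : G) (x : M) : M :=
  SigSub (mem_set (invM g (set_valP x))).

(** Universality quantifies over topological types, so a minimal subset has to
    be turned into a type of its own. *)
Lemma restrict_act_minimal : hausdorff_space T -> compact M -> minimal_set M ->
  minimal_compact_action restrict_act.
Proof.
move=> hT cM minM; have valc : continuous (set_val : M -> T) by exact: initial_continuous.
have cT : compact [set: M].
  move=> F FF _; have [|p [Mp clp]] := cM (set_val @ F) _.
    change (F (set_val @^-1` M)).
    by apply: filterE => x; exact: set_valP.
  exists (SigSub (mem_set Mp)); split=> // A B FA [_ [[V oV <-] /= Vp] VB].
  have [_ [[z Az <-] Vz]] := clp (set_val @` A) V
    (filterS (fun z Az => ex_intro2 _ _ z Az erefl) FA) (open_nbhs_nbhs (conj oV Vp)).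
  by exists z; split=> //; exact: VB.
split=> //.
- by have [x Mx] := minimal_nonempty minM; exists (SigSub (mem_set Mx)).
- move=> p q clpq; apply/val_inj/hT => A B Ap Bq.
  have [z [Az Bz]] := clpq _ _ (valc _ _ Ap) (valc _ _ Bq).
  by exists (set_val z).
- split=> [x|g h x|g].
  + by apply/val_inj; rewrite /= (action1 contact).
  + by apply/val_inj; rewrite /= (actionM contact).
  + apply: continuous_comp_initial => x.
    by apply: (@continuous_comp _ _ _ set_val (act g)); [exact: valc|exact: action_continuous].
move=> _ [V oV <-] [u Vu] invU; apply/seteqP; split=> // x _.
apply: contrapT => nVx.
have E : M `&` ~` V = M.
  apply: (minimal_least minM).
  - by apply: closedI; [exact: minimal_closed minM|exact: open_closedC].
  - by exists (set_val x); split=> //; exact: set_valP.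
  - move=> g y [My nVy]; split; first exact: invM.
    move=> Vgy; apply: nVy.
    have : (restrict_act g^-1%g @` (set_val @^-1` V)) (SigSub (mem_set My)).
      exists (SigSub (mem_set (invM g My))) => //.
      by apply/val_inj; rewrite /= actK.
    by rewrite invU.
  - by move=> y [].
have : (M `&` ~` V) (set_val u) by rewrite E; exact: set_valP.
by case.
Qed.

End Restriction.
End MinimalSets.

(** * The Ellis semigroup of a universal minimal action *)

Lemma closed_image (S T : topologicalType) (f : S -> T) (A : set S) :
  compact [set: S] -> hausdorff_space T -> continuous f -> closed A ->
  closed (f @` A).
Proof.
move=> cS hT cf clA; apply: compact_closed => //.
apply: continuous_compact; first exact: continuous_subspaceT.
by apply: (subclosed_compact clA cS).
Qed.

Lemma minimal_action_closed (G : groupType) (X : topologicalType)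
    (act : G -> X -> X) (A : set X) :
  minimal_compact_action act -> closed A -> A !=set0 -> invariant_set act A ->
  A = [set: X].
Proof.
move=> mca clA [a Aa] invA; have contact := mca_action mca.
apply/eqP/negPn/negP => /eqP neA.
have nA : ~` A !=set0.
  apply: contrapT => nA; apply: neA; apply/seteqP; split=> // x _.
  by apply: contrapT => nAx; apply: nA; exists x.
have : ~` A = [set: X].
  apply: (mca_minimal mca) => //; first exact: closed_openC.
  move=> g; apply/seteqP; split=> [_ [y nAy <-] Agy|y nAy].
    by apply: nAy; rewrite -(actK contact g y); exact: invA.
  exists (act g^-1%g y); last exact: actVK.
  by move=> Agy; apply: nAy; rewrite -(actVK contact g y); exact: invA.
by move=> /seteqP[_ /(_ a I)].
Qed.

Section Ellis.
Context {G : groupType} {X : topologicalType} (act : G -> X -> X).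
Hypothesis univ : universal_minimal_action act.
Let mca := univ.1.
Let contact := mca_action mca.
Let hX := mca_hausdorff mca.
Local Notation XX := {ptws X -> X}.
Implicit Types (p q r : XX).

Definition pact (g : G) p : XX := fun x => act g (p x).

Definition pcomp p q : XX := fun x => p (q x).

Lemma eval_act_continuous (g : G) x : continuous (fun p => act g (p x)).
Proof.
move=> p; apply: (@continuous_comp _ _ _ (fun p => p x) (act g)).
  exact: ptws_eval_continuous.
exact: action_continuous.
Qed.

Lemma pact_continuous_action : continuous_action pact.
Proof.
split=> [p|g h p|g].
- by apply/funext => x; exact: (action1 contact).
- by apply/funext => x; exact: (actionM contact).
- by apply: ptws_continuous => x; exact: eval_act_continuous.
Qed.

Lemma pcomp_continuous q : continuous (pcomp ^~ q).
Proof. by apply: ptws_continuous => x; exact: ptws_eval_continuous. Qed.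

Definition ellis : set XX := closure (range (pact^~ (id : XX))).

Lemma ellis_ind (C : set XX) : closed C -> (forall g, C (act g)) -> ellis `<=` C.
Proof.
move=> clC Cact; rewrite (closure_id C).1//; apply: closureS.
by move=> _ [g _ <-]; exact: Cact.
Qed.

Lemma ptws_hausdorff : hausdorff_space XX.
Proof. exact: (@hausdorff_product X (fun=> X)). Qed.

Lemma ptws_compact : compact [set: XX].
Proof.
have := @tychonoff X (fun=> X) (fun=> setT) (fun=> mca_compact mca).
by congr (compact _); apply/seteqP; split.
Qed.

Lemma ellis_commute (f : X -> X) p x : continuous f ->
  (forall g y, f (act g y) = act g (f y)) -> ellis p -> f (p x) = p (f x).
Proof.
move=> cf fE; apply: (ellis_ind (C := [set p | f (p x) = p (f x)])) => [|g /=].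
  apply: closed_equalizer => //; last exact: ptws_eval_continuous.
  move=> q; apply: (@continuous_comp _ _ _ (fun p : XX => p x) f).
    exact: ptws_eval_continuous.
  exact: cf.
exact: fE.
Qed.

Section MinimalIdeal.
Variable L : set XX.
Hypotheses (minL : minimal_set pact L) (L_ellis : L `<=` ellis).

(** Composition on the right by a fixed map is continuous for pointwise
    convergence, so a property that is closed in p passes from G to its closure;
    this makes the G-invariant closed set L a left ideal. *)
Lemma ideal_pcomp p q : ellis p -> L q -> L (pcomp p q).
Proof.
move=> Ep Lq; move: p Ep; apply: (ellis_ind (C := [set p | L (pcomp p q)])).
  apply: closed_comp; last exact: minimal_closed minL.
  by move=> x _; exact: pcomp_continuous.
by move=> g; exact: (minimal_invariant minL).
Qed.

Lemma ideal_translate r : L r -> (pcomp ^~ r) @` L = L.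
Proof.
move=> Lr; apply: (minimal_least minL).
- apply: closed_image; [exact: ptws_compact|exact: ptws_hausdorff| |].
    exact: pcomp_continuous.
  exact: minimal_closed minL.
- by have [p Lp] := minimal_nonempty minL; exists (pcomp p r); exists p.
- move=> g _ [p Lp <-]; exists (pact g p) => //.
  exact: (minimal_invariant minL).
- by move=> _ [p Lp <-]; apply: ideal_pcomp => //; exact: L_ellis.
Qed.

(** The theorem of Ellis and Numakura: in a minimal closed subsemigroup U of
    the stabilizer of r, U u = U for every u in U, so u is fixed by some p in U,
    and the p that fix u form a closed subsemigroup, hence contain u. *)
Lemma ideal_idempotent r : L r ->
  exists u, [/\ L u, pcomp u u = u & pcomp u r = r].
Proof.
move=> Lr.
pose Q (A : set XX) := [/\ closed A, A !=set0 & forall p q, A p -> A q -> A (pcomp p q)].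
pose A0 := L `&` [set p | pcomp p r = r].
have clA0 : closed A0.
  apply: closedI; first exact: minimal_closed minL.
  apply: closed_equalizer; first exact: ptws_hausdorff.
    exact: pcomp_continuous.
  exact: cst_continuous.
have QA0 : Q A0.
  split=> //.
    by have [p Lp pr] : ((pcomp ^~ r) @` L) r by [rewrite ideal_translate]; exists p.
  move=> p q [Lp pr] [Lq qr]; split; first exact/ideal_pcomp/Lq/L_ellis.
  by rewrite /= -[in RHS]pr -[in RHS]qr.
have [|U [[clU [u Uu] UM] UA minU]] := minimal_closed_set QA0.
  move=> F F0 totF FQ; split.
  - by apply: closed_bigI => A /FQ[[]].
  - apply: (chain_bigcap_nonempty ptws_compact) => // A /FQ[[clA nA _] _].
    by split=> //; exact: subsetT.
  - move=> p q Fp Fq A FA; have [[_ _ AM] _] := FQ _ FA.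
    by apply: AM; [exact: Fp|exact: Fq].
have Uu_eq : (pcomp ^~ u) @` U = U.
  apply: minU; last by move=> _ [p Up <-]; exact: UM.
  split.
  - by apply: closed_image => //; [exact: ptws_compact|exact: ptws_hausdorff|exact: pcomp_continuous].
  - by exists (pcomp u u); exists u.
  - move=> _ _ [p Up <-] [q Uq <-]; exists (pcomp (pcomp p u) q) => //.
    exact: UM (UM _ _ Up Uu) Uq.
have Uu_fix : U `&` [set p | pcomp p u = u] = U.
  apply: minU; last by move=> ? [].
  split.
  - apply: closedI => //; apply: closed_equalizer; first exact: ptws_hausdorff.
      exact: pcomp_continuous.
    exact: cst_continuous.
  - by have [p Up pu] : ((pcomp ^~ u) @` U) u by [rewrite Uu_eq]; exists p.
  - move=> p q [Up pu] [Uq qu]; split; first exact: UM.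
    by rewrite /= -[in RHS]pu -[in RHS]qu.
have [Lu ur] := UA _ Uu; exists u; split=> //.
by have : (U `&` [set p | pcomp p u = u]) u by [rewrite Uu_fix]; case.
Qed.

(** In L, r has a right inverse: if u is an idempotent with u r = r, then
    s r = u and t s = u for some s and t, which forces t = r and r s = u; and u
    is a right unit of L. *)
Lemma ideal_cancel p q r : L p -> L q -> L r -> pcomp p r = pcomp q r -> p = q.
Proof.
move=> Lp Lq Lr pqr.
have [u [Lu uu ur]] := ideal_idempotent Lr.
have fixu v : L v -> pcomp v u = v.
  move=> Lv; have [w Lw wv] : ((pcomp ^~ u) @` L) v by rewrite ideal_translate.
  by rewrite -wv; apply/funext => x; rewrite /pcomp -[u (u x)]/(pcomp u u x) uu.
have [s Ls sr] : ((pcomp ^~ r) @` L) u by rewrite ideal_translate.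
have [t Lt ts] : ((pcomp ^~ s) @` L) u by rewrite ideal_translate.
have tr : t = r.
  have {}sr : pcomp s r = u := sr; have {}ts : pcomp t s = u := ts.
  transitivity (pcomp t (pcomp s r)); first by rewrite sr fixu.
  transitivity (pcomp (pcomp t s) r); first by [].
  by rewrite ts.
rewrite -(fixu _ Lp) -(fixu _ Lq) -ts tr; apply/funext => x.
exact: (congr1 (fun f : XX => f (s x)) pqr).
Qed.

(** Universality maps X to L by some theta, with theta (p y) = p theta (y) for
    p in L; then p y = q y gives p theta (y) = q theta (y), and theta (y) can be
    cancelled. *)
Lemma ideal_free y p q : L p -> L q -> p y = q y -> p = q.
Proof.
move=> Lp Lq pq.
have [theta [ctheta _ thetaE]] :=
  univ.2 _ _ (restrict_act_minimal pact_continuous_action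
    (minimal_invariant minL) ptws_hausdorff
    (subclosed_compact (minimal_closed minL) ptws_compact (@subsetT _ _)) minL).
pose th x : XX := set_val (theta x).
have thE x v : ellis v -> th (v x) = pcomp v (th x).
  move=> Ev; apply/funext => z; move: v Ev.
  apply: (ellis_ind (C := [set v | th (v x) z = pcomp v (th x) z])) => [|g /=].
    apply: closed_equalizer => //; last exact: ptws_eval_continuous.
    move=> v; apply: (@continuous_comp _ _ _ (fun v : XX => v x) (fun x => th x z)).
      exact: ptws_eval_continuous.
    apply: (@continuous_comp _ _ _ th (fun q : XX => q z)); last exact: ptws_eval_continuous.
    apply: (@continuous_comp _ _ _ theta set_val); first exact: ctheta.
    exact: initial_continuous.
  by rewrite /th thetaE.
have Lth x : L (th x) by exact: set_valP.
apply: (ideal_cancel Lp Lq (Lth y)).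
by rewrite -!thE ?pq//; exact: L_ellis.
Qed.

Lemma ideal_orbit y x : exists2 p, L p & p y = x.
Proof.
have cy : continuous (fun p : XX => p y) by exact: ptws_eval_continuous.
have : ((fun p : XX => p y) @` L) = setT.
  apply: (minimal_action_closed mca).
  - apply: closed_image => //; [exact: ptws_compact|exact: minimal_closed minL].
  - by have [p Lp] := minimal_nonempty minL; exists (p y); exists p.
  - move=> g _ [p Lp <-]; exists (pact g p) => //.
    exact: (minimal_invariant minL).
by move=> /seteqP[_ /(_ x I)[p Lp px]]; exists p.
Qed.

End MinimalIdeal.

(** All points are p x0 with p in L, and f (p x0) = p (f x0) determines p. *)
Lemma universal_coalescent (f : X -> X) : continuous f ->
  (forall g x, f (act g x) = act g (f x)) ->
  injective f /\ set_surj [set: X] [set: X] f.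
Proof.
move=> cf fE.
have [L minL LE] := exists_minimal_set (act := pact)
  (subclosed_compact (@closed_closure _ _) ptws_compact (@subsetT _ _))
  (@closed_closure _ _) (ex_intro _ _ (subset_closure (ex_intro2 _ _ 1%g I erefl)))
  (closure_orbit_invariant pact_continuous_action (x := id)).
have [x0 _] := mca_nonempty mca; split=> [x y fxy|].
  have [p Lp px] := ideal_orbit minL x0 x.
  have [q Lq qy] := ideal_orbit minL x0 y.
  rewrite -px -qy; congr (_ x0); apply: (ideal_free minL LE Lp Lq (y := f x0)).
  rewrite -(ellis_commute x0 cf fE (LE _ Lp)) -(ellis_commute x0 cf fE (LE _ Lq)).
  by rewrite px qy.
suff /seteqP[_] : f @` setT = setT by [].
apply: (minimal_action_closed mca).
- by apply: closed_image => //; exact: mca_compact mca.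
- by exists (f x0); exists x0.
- by move=> g _ [x _ <-]; exists (act g x).
Qed.

End Ellis.

(** * Labellings, freeness and comparison *)

Lemma hausdorff_injective_continuous (S T1 T2 : topologicalType)
    (f1 : S -> T1) (f2 : S -> T2) :
  continuous f1 -> continuous f2 -> hausdorff_space T1 -> hausdorff_space T2 ->
  (forall p q, f1 p = f1 q -> f2 p = f2 q -> p = q) -> hausdorff_space S.
Proof.
move=> cf1 cf2 h1 h2 inj p q clpq; apply: inj; [apply: h1|apply: h2] => A B Ap Bq.
  by have [z [Az Bz]] := clpq _ _ (cf1 _ _ Ap) (cf1 _ _ Bq); exists (f1 z).
by have [z [Az Bz]] := clpq _ _ (cf2 _ _ Ap) (cf2 _ _ Bq); exists (f2 z).
Qed.

Section Labelling.
Context {G : groupType} {X : topologicalType} (act : G -> X -> X).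
Hypothesis univ : universal_minimal_action act.
Let mca := univ.1.
Let contact := mca_action mca.
Let hX := mca_hausdorff mca.
Local Notation Z := (X * {ptws G -> nat})%type.

(** Multiplying h by g on the right makes this a left action, for which the
    translate by g of a colouring c has the value c g at 1. *)
Definition label_act (g : G) (z : Z) : Z := (act g z.1, fun h => z.2 (h * g)%g).

Lemma label_fst_continuous : continuous (fst : Z -> X).
Proof. by move=> z; exact: cvg_fst. Qed.

Lemma label_snd_continuous h : continuous (fun z : Z => z.2 h).
Proof.
move=> z; apply: (@continuous_comp _ _ _ (snd : Z -> _) (fun d => d h)).
  exact: cvg_snd.
exact: (@ptws_eval_continuous G nat).
Qed.

Lemma label_continuous_action : continuous_action label_act.
Proof.
split=> [[x d]|g h [x d]|g].
- rewrite /label_act/= (action1 contact); congr (_, _).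
  by apply/funext => h; rewrite mulg1.
- rewrite /label_act/= (actionM contact); congr (_, _).
  by apply/funext => k; rewrite mulgA.
- have c1 : continuous (fun z : Z => act g z.1).
    move=> z; apply: (@continuous_comp _ _ _ (fst : Z -> _) (act g)); first exact: cvg_fst.
    exact: action_continuous.
  have c2 : continuous (fun z : Z => (fun h => z.2 (h * g)%g) : {ptws G -> nat}).
    by apply: ptws_continuous => h; exact: label_snd_continuous.
  by move=> z; exact: (cvg_pair (c1 z) (c2 z)).
Qed.

Lemma label_hausdorff : hausdorff_space Z.
Proof.
have sndc : continuous (snd : Z -> {ptws G -> nat}) by move=> z; exact: cvg_snd.
apply: (hausdorff_injective_continuous label_fst_continuous sndc hX).
  apply: (@hausdorff_product G (fun=> nat)) => _; exact: order_hausdorff.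
by move=> [x d] [y e] /= -> ->.
Qed.

(** The label of x is the value at 1 of the colouring in the point of Z over
    x, and equivariance shows that the value at h is the label of h x. The map
    from X to Z given by universality is only a section of the projection up to
    an endomorphism f of X; coalescence allows inverting f. *)
Lemma orbit_labelling (c : G -> nat) (N : nat) (x0 : X) :
  (forall g, (c g <= N)%N) ->
  exists lam : X -> nat, continuous lam /\
    forall x (U : set X) (F : seq G), nbhs x U ->
      exists g, U (act g x0) /\ forall h, h \in F -> c (h * g)%g = lam (act h x).
Proof.
move=> cN; pose z0 : Z := (x0, c).
pose A := closure (range (label_act^~ z0)).
pose K : set Z := [set: X] `*` [set d : {ptws G -> nat} | forall h, (d h <= N)%N].
have cK : compact K.
  apply: compact_setX; first exact: mca_compact mca.
  apply: (@tychonoff G (fun=> nat) (fun=> [set n | (n <= N)%N])) => _.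
  by apply: finite_compact; exact: (finite_II N.+1).
have AK : A `<=` K.
  rewrite (closure_id K).1; last exact: compact_closed label_hausdorff cK.
  by apply: closureS => _ [g _ <-]; split=> //= h.
have cA : compact A by apply: subclosed_compact AK => //; exact: closed_closure.
have [M minM MA] := exists_minimal_set cA (@closed_closure _ _)
  (ex_intro _ _ (subset_closure (ex_intro2 _ _ 1%g I erefl)))
  (closure_orbit_invariant label_continuous_action (x := z0)).
have [phi [cphi _ phiE]] :=
  univ.2 _ _ (restrict_act_minimal label_continuous_action
    (minimal_invariant minM) label_hausdorff
    (subclosed_compact (minimal_closed minM) cA MA) minM).
pose ph x : Z := set_val (phi x).
have cph : continuous ph.
  move=> x; apply: (@continuous_comp _ _ _ phi set_val); first exact: cphi.
  exact: initial_continuous.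
have phE g x : ph (act g x) = label_act g (ph x) by rewrite /ph phiE.
pose f x := (ph x).1.
have cf : continuous f.
  move=> x; apply: (@continuous_comp _ _ _ ph fst); first exact: cph.
  exact: cvg_fst.
have fE g x : f (act g x) = act g (f x) by rewrite /f phE.
have [injf surjf] := universal_coalescent univ cf fE.
have fonto x : exists y, f y = x by have [y _ <-] := surjf x I; exists y.
have [finv finvK] := choice fonto.
have finvE g x : finv (act g x) = act g (finv x).
  by apply: injf; rewrite fE !finvK.
pose lam0 x := (ph x).2 1%g.
have lam0E h x : lam0 (act h x) = (ph x).2 h by rewrite /lam0 phE /= mul1g.
have clam0 : continuous lam0.
  move=> x; apply: (@continuous_comp _ _ _ ph (fun z : Z => z.2 1%g)); first exact: cph.
  exact: label_snd_continuous.
exists (lam0 \o finv); split.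
  apply/continuous_closedP => D clD.
  rewrite (_ : _ @^-1` D = f @` (lam0 @^-1` D)).
    apply: closed_image => //; first exact: mca_compact mca.
    by apply: closed_comp clD => x _; exact: clam0.
  apply/seteqP; split=> [x Dx|_ [x Dx <-]]; first by exists (finv x).
  by rewrite /= (_ : finv (f x) = x)//; apply: injf; rewrite finvK.
move=> x U F Ux.
pose V : set Z := [set z | U z.1 /\ forall h, h \in F -> z.2 h = (ph (finv x)).2 h].
have Vph : nbhs (ph (finv x)) V.
  apply: (@filterI Z (nbhs (ph (finv x)))).
    apply: label_fst_continuous; rewrite -/(f _) finvK; exact: Ux.
  elim: F {V} => [|h F IH]; first by apply: (@filterS Z _ _ setT); [move=> z _ h|exact: filterT].
  have nh : nbhs (ph (finv x)) [set z : Z | z.2 h = (ph (finv x)).2 h].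
    by apply: (label_snd_continuous (h := h) (t := [set n | n = (ph (finv x)).2 h])).
  apply: (@filterS2 Z (nbhs (ph (finv x))) _ _ _ _ _ nh IH) => z zh zF k.
  by rewrite inE => /predU1P[->//|]; exact: zF.
have Aph : A (ph (finv x)) by apply: MA; exact: set_valP.
have [_ [[g _ <-] [Ug VF]]] := Aph V Vph.
exists g; split=> // h hF; rewrite /= finvE lam0E -VF//.
Qed.

(** A maximal set A disjoint from t A gets one colour; every other g lies in
    t A or in t^-1 A, which gives the two other colours. *)
Lemma translation_colouring (t : G) : t <> 1%g ->
  exists c : G -> nat, (forall g, (c g <= 2)%N) /\ forall g, c (t * g)%g <> c g.
Proof.
move=> t1; pose indep (A : set G) := forall g, A g -> ~ A (t * g)%g.
have [|A [indA maxA]] := @Zorn_bigcup _ indep.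
  move=> F FP totF g [B FB Bg] [C FC Ctg].
  have [BC|CB] := totF _ _ FB FC; first exact: FP FC _ (BC _ Bg) Ctg.
  exact: FP FB _ Bg (CB _ Ctg).
have cover g : ~ A g -> A (t^-1 * g)%g \/ A (t * g)%g.
  move=> nAg; apply: contrapT => /not_orP[nA1 nA2].
  apply: (maxA (A `|` [set g])); first by split=> [y|sub]; [left|apply/nAg/sub; right].
  move=> h [Ah|->] [Ath|].
  - exact: indA Ah Ath.
  - by move=> thg; apply: nA1; rewrite -thg mulKg.
  - exact: nA2.
  - by move=> tg; apply: t1; apply: (mulIg g); rewrite mul1g.
exists (fun g => if `[< A g >] then 0 else if `[< A (t^-1 * g)%g >] then 1 else 2)%N.
split=> g; first by case: asboolP => // _; case: asboolP.
rewrite mulKg; case: (asboolP (A g)) => [Ag|nAg].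
  by rewrite asboolF; last exact: indA.
by case: (cover g nAg) => [/asboolT->|/asboolT->]; case: asboolP.
Qed.

(** For the pattern formed by 1 and t, the labels of x and t x are the colours
    of some g and t g. *)
Lemma universal_action_free (t : G) (x : X) : t <> 1%g -> act t x <> x.
Proof.
move=> /translation_colouring[c [c2 ct]] tx.
have [lam [_ lamP]] := @orbit_labelling c 2 x c2.
have [g [_ gP]] := lamP x setT [:: 1%g; t] filterT.
have := gP 1%g; have := gP t; rewrite !inE !eqxx /= orbT tx (action1 contact) mul1g.
by move=> /(_ isT) <- /(_ isT) /esym/ct.
Qed.

(** The translates of V form an invariant open set. *)
Lemma minimal_finite_cover (V : set X) : open V -> V !=set0 ->
  exists K : {fset G}, forall x, exists2 k, k \in K & V (act k^-1%g x).
Proof.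
move=> oV V0.
pose W := \bigcup_k (act k^-1%g @^-1` V).
have oV' k : open (act k^-1%g @^-1` V).
  by apply: open_comp oV => x _; exact: action_continuous.
have WT : W = [set: X].
  apply: (mca_minimal mca).
  - by apply: bigcup_open => k _; exact: oV'.
  - by have [v Vv] := V0; exists v; exists 1%g => //=; rewrite invg1 (action1 contact).
  - move=> g; apply/seteqP; split=> [_ [x [k _ Vk] <-]|x [k _ Vk]].
      by exists (g * k)%g => //=; rewrite -(actionM contact) invgM mulgVK.
    exists (act g^-1%g x); last exact: actVK.
    by exists (g^-1 * k)%g => //=; rewrite -(actionM contact) invgM invgK mulgK.
pose P (K : {fset G}) x := exists2 k, k \in K & V (act k^-1%g x).
have FT := @summability.totally_filter G.
have nK : \forall K \near @summability.totally G, [set: X] `<=` P K.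
  apply: (compact_near_coveringP _).1; first exact: mca_compact mca.
  move=> x _; have [k _ Vk] : W x by rewrite WT.
  exists (act k^-1%g @^-1` V, [set K | [fset k]%fset `<=` K]%fset).
    split; last by exists [fset k]%fset.
    apply: open_nbhs_nbhs; split; [exact: oV'|exact: Vk].
  move=> [y K] /= [Vy]; rewrite fsub1set => kK.
  by exists k.
have [K Kcov] := filter_ex nK.
by exists K => x; exact: Kcov.
Qed.

(** The colour of g is the translation h g that moves g x0 into V, for V open
    with closure in U. Two points moved to the same place differ by an element t
    of G, and injectivity of g |-> h g g forces t = 1. *)
Lemma universal_comparison (R : realType) (U : set X) :
  ~ amenable R G -> open U -> U !=set0 ->
  exists (E : {fset G}) (h : X -> G), [/\ forall x, h x \in E,
    forall e, open (h @^-1` [set e]), forall x, U (act (h x) x)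
    & injective (fun x => act (h x) x)].
Proof.
move=> namen oU [x0 Ux0].
have [V [oV Vx0 clVU]] : exists V, [/\ open V, V x0 & closure V `<=` U].
  have Ux : nbhs x0 U by exact: open_nbhs_nbhs.
  have [W Wx0 WU] := compact_regular hX (mca_compact mca) filterT Ux.
  exists (interior W); split; [exact: open_interior|exact: Wx0|].
  by apply: subset_trans WU; apply: closureS; exact: interior_subset.
have [K Kcov] := minimal_finite_cover oV (ex_intro _ x0 Vx0).
have synd g : exists2 k, k \in K & V (act (k^-1 * g)%g x0).
  by have [k kK Vk] := Kcov (act g x0); exists k; rewrite // (actionM contact).
have [E [h [hE hV hinj]]] := @syndetic_injection R G [set g | V (act g x0)] K namen synd.
(* The translations, elements of E, are numbered to make a colouring. *)
pose e n := nth 1%g E n; pose c g := index (h g) E.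
have ec g : e (c g) = h g by rewrite /e /c nth_index.
have [lam [clam lamP]] := @orbit_labelling c #|` E| x0 (fun g => index_size _ _).
have key x (W : set X) (t : G) : nbhs x W ->
    exists g, [/\ W (act g x0), c g = lam x & c (t * g)%g = lam (act t x)].
  move=> Wx; have [g [Wg gP]] := lamP x W [:: 1%g; t] Wx; exists g; split=> //.
    by have := gP 1%g; rewrite mul1g (action1 contact) => ->//; rewrite !inE eqxx.
  by apply: gP; rewrite !inE eqxx orbT.
exists E, (e \o lam); split=> [x|a|x|x y /= hxy].
- have [g [_ gx _]] := key x setT 1%g filterT.
  by rewrite /= -gx ec.
- rewrite comp_preimage; apply: open_comp; first by move=> x _; exact: clam.
  exact: discrete_open.
- apply: clVU => W Wx.
  have [g [Wg gx _]] := key x (act (e (lam x)) @^-1` W) 1%g (action_continuous contact Wx).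
  exists (act (e (lam x)) (act g x0)); split=> //.
  by rewrite -(actionM contact) -gx ec; exact: hV.
pose t := ((e (lam y))^-1 * e (lam x))%g.
have yE : y = act t x by rewrite (actionM contact) hxy actK.
have [g [_ gx gy]] := key x setT t filterT.
have : (t * g)%g = g.
  apply: hinj; rewrite /= -!ec gx gy -yE /t !mulgA mulgV mul1g //.
by rewrite yE => tg; rewrite (_ : t = 1%g) ?(action1 contact)//; apply: (mulIg g); rewrite mul1g.
Qed.

End Labelling.

(** * The norm of l^2(I) *)

Section FiniteSums.
Variables (R : realType) (I : Type).
Implicit Types (s : seq I) (a b : I -> R).

Lemma finite_cauchy_schwarz s a b (x y : R) : 0 <= x -> 0 <= y ->
  \sum_(i <- s) a i ^+ 2 <= x ^+ 2 -> \sum_(i <- s) b i ^+ 2 <= y ^+ 2 ->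
  \sum_(i <- s) a i * b i <= x * y.
Proof.
have zero (c d : I -> R) : \sum_(i <- s) c i ^+ 2 <= 0 ^+ 2 -> \sum_(i <- s) c i * d i = 0.
  rewrite expr0n /= => c0.
  have sq0 : \sum_(i <- s) c i ^+ 2 = 0.
    by apply/eqP; rewrite eq_le c0 sumr_ge0// => i _; exact: sqr_ge0.
  elim: s {c0} sq0 => [|i s IH]; rewrite ?big_nil// !big_cons.
  have : 0 <= \sum_(j <- s) c j ^+ 2 by apply: sumr_ge0 => j _; exact: sqr_ge0.
  move=> s0 /eqP; rewrite paddr_eq0 ?sqr_ge0// sqrf_eq0 => /andP[/eqP-> /eqP/IH->].
  by rewrite mul0r addr0.
rewrite le_eqVlt => /predU1P[<- _ /zero-> _|x0]; first by rewrite mul0r.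
rewrite le_eqVlt => /predU1P[<- _ /zero|y0 ax bx].
  by move=> b0; under eq_bigr do rewrite mulrC; rewrite b0 mulr0.
have : 0 <= \sum_(i <- s) (y * a i - x * b i) ^+ 2.
  by apply: sumr_ge0 => i _; exact: sqr_ge0.
have -> : \sum_(i <- s) (y * a i - x * b i) ^+ 2 =
    y ^+ 2 * \sum_(i <- s) a i ^+ 2 - (2 * x * y) * \sum_(i <- s) a i * b i
    + x ^+ 2 * \sum_(i <- s) b i ^+ 2.
  by rewrite !mulr_sumr -sumrB -big_split /=; apply: eq_bigr => i _; ring.
move=> h; have xy0 : 0 < 2 * x * y by rewrite !mulr_gt0.
rewrite -(ler_pM2l xy0).
have := ler_wpM2l (sqr_ge0 y) ax; have := ler_wpM2l (sqr_ge0 x) bx; lra.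
Qed.

Lemma finite_minkowski s a b (x y : R) : 0 <= x -> 0 <= y ->
  \sum_(i <- s) a i ^+ 2 <= x ^+ 2 -> \sum_(i <- s) b i ^+ 2 <= y ^+ 2 ->
  \sum_(i <- s) (a i + b i) ^+ 2 <= (x + y) ^+ 2.
Proof.
move=> x0 y0 ax bx; have ab := finite_cauchy_schwarz x0 y0 ax bx.
have -> : \sum_(i <- s) (a i + b i) ^+ 2 = \sum_(i <- s) a i ^+ 2
    + 2 * \sum_(i <- s) a i * b i + \sum_(i <- s) b i ^+ 2.
  by rewrite mulr_sumr -!big_split /=; apply: eq_bigr => i _; ring.
lra.
Qed.

End FiniteSums.

Section L2Norm.
Variables (R : realType) (I : choiceType).
Local Notation H := (l2 R I).
Implicit Types (x y z : H) (A : {fset I}) (f : I -> R[i]^o).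

Lemma normc_ge0 (z : R[i]) : 0 <= normc z.
Proof. by case: z => a b; exact: sqrtr_ge0. Qed.

Lemma l2_sum_ge f A : ((\sum_(i <- A) normc (f i) ^+ 2)%:E <= l2_sum f)%E.
Proof.
apply: esum_ge; exists [set` A]; first by split.
by rewrite fsbig_finite//= set_fsetK sumEFin.
Qed.

Lemma l2_sum_le f (M : R) : (forall A, \sum_(i <- A) normc (f i) ^+ 2 <= M) ->
  (l2_sum f <= M%:E)%E.
Proof.
move=> fM; apply: ge_ereal_sup => _ [B [finB _] <-].
by rewrite fsbig_finite//= sumEFin lee_fin.
Qed.

Lemma square_summableP f :
  reflect (exists M : R, forall A, \sum_(i <- A) normc (f i) ^+ 2 <= M)
    (f \in square_summable (R := R) (I := I)).
Proof.
apply: (iffP idP) => [/asboolP ffin|[M fM]].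
  have f0 : (0 <= l2_sum f)%E by apply: esum_ge0 => i _; rewrite lee_fin sqr_ge0.
  exists (fine (l2_sum f)) => A.
  by rewrite -lee_fin fineK ?l2_sum_ge// ge0_fin_numE.
by apply/asboolP; apply: le_lt_trans (l2_sum_le fM) (ltry _).
Qed.

Lemma l2_norm_ge0 x : 0 <= l2_norm x. Proof. exact: sqrtr_ge0. Qed.

Lemma l2_sumE x : l2_sum x = (l2_norm x ^+ 2)%:E.
Proof.
have x0 : (0 <= l2_sum x)%E by apply: esum_ge0 => i _; rewrite lee_fin sqr_ge0.
have /asboolP xfin := l2_valP x.
by rewrite /l2_norm sqr_sqrtr ?fine_ge0// fineK// ge0_fin_numE.
Qed.

Lemma l2_norm_ge x A : \sum_(i <- A) normc (x i) ^+ 2 <= l2_norm x ^+ 2.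
Proof. by rewrite -lee_fin -l2_sumE; exact: l2_sum_ge. Qed.

Lemma l2_norm_le x (M : R) : 0 <= M ->
  (forall A, \sum_(i <- A) normc (x i) ^+ 2 <= M ^+ 2) -> l2_norm x <= M.
Proof.
move=> M0 /l2_sum_le; rewrite l2_sumE lee_fin => h.
by rewrite -(@ler_pXn2r _ 2) ?nnegrE// l2_norm_ge0.
Qed.

Lemma l2_normP x (M : R) : 0 <= M -> l2_norm x <= M ->
  forall A, \sum_(i <- A) normc (x i) ^+ 2 <= M ^+ 2.
Proof.
move=> M0 xM A; apply: le_trans (l2_norm_ge x A) _.
by rewrite lerXn2r ?nnegrE// l2_norm_ge0.
Qed.

Lemma l2_coord_le x i : normc (x i) <= l2_norm x.
Proof.
rewrite -(@ler_pXn2r _ 2) ?nnegrE ?l2_norm_ge0 ?normc_ge0//.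
by have := l2_norm_ge x [fset i]%fset; rewrite big_seq_fset1.
Qed.

Lemma l2D x y i : (x + y) i = x i + y i. Proof. by []. Qed.
Lemma l2N x i : (- x) i = - x i. Proof. by []. Qed.
Lemma l2Z (c : R[i]) x i : (c *: x) i = (c * x i :> R[i]). Proof. by []. Qed.
Lemma l20 i : (0 : H) i = 0. Proof. by []. Qed.

Lemma l2_ext x y : (forall i, x i = y i) -> x = y.
Proof. by move=> xy; apply/val_inj/funext. Qed.

Lemma l2_norm0_eq x : l2_norm x = 0 -> x = 0.
Proof.
move=> x0; apply: l2_ext => i; apply/eq0_normc/eqP.
by rewrite eq_le normc_ge0 -x0 l2_coord_le.
Qed.

Lemma l2_norm0 : l2_norm (0 : H) = 0.
Proof.
apply/eqP; rewrite eq_le l2_norm_ge0 andbT; apply: l2_norm_le => // A.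
by rewrite big1 ?expr0n// => i _; rewrite l20 normc0 expr0n.
Qed.

Lemma l2_norm_triangle x y : l2_norm (x + y) <= l2_norm x + l2_norm y.
Proof.
apply: l2_norm_le => [|A]; first by rewrite addr_ge0 ?l2_norm_ge0.
apply: le_trans (finite_minkowski (l2_norm_ge0 x) (l2_norm_ge0 y)
  (l2_norm_ge x A) (l2_norm_ge y A)).
apply: ler_sum => i _; rewrite lerXn2r ?nnegrE ?addr_ge0 ?normc_ge0//.
exact: le_normcD.
Qed.

Lemma l2_normZ (c : R[i]) x : l2_norm (c *: x) = normc c * l2_norm x.
Proof.
have le (d : R[i]) z : l2_norm (d *: z) <= normc d * l2_norm z.
  apply: l2_norm_le => [|A]; first by rewrite mulr_ge0 ?l2_norm_ge0 ?normc_ge0.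
  under eq_bigr do rewrite l2Z normcM exprMn.
  by rewrite -mulr_sumr exprMn ler_wpM2l ?sqr_ge0// l2_norm_ge.
have [->|c0] := eqVneq c 0; first by rewrite scale0r l2_norm0 normc0 mul0r.
apply/eqP; rewrite eq_le le /=.
have n0 : 0 < normc c.
  by rewrite lt_neqAle normc_ge0 andbT eq_sym; apply: contraNneq c0 => /eq0_normc->.
rewrite -ler_pdivlMl// -normcV -{1}[x](scale1r) -(mulVf c0) -scalerA; exact: le.
Qed.

Lemma l2_normN x : l2_norm (- x) = l2_norm x.
Proof. by rewrite -scaleN1r l2_normZ normcN normc1 mul1r. Qed.

Lemma l2_normB x y : l2_norm (x - y) <= l2_norm x + l2_norm y.
Proof. by rewrite -(l2_normN y); exact: l2_norm_triangle. Qed.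

Lemma l2_dist_triangle y x z : l2_norm (x - z) <= l2_norm (x - y) + l2_norm (y - z).
Proof. by rewrite -{1}(subrK y x) -addrA; exact: l2_norm_triangle. Qed.

End L2Norm.

(** * Completeness of l^2(I) and unconditional sums *)

Section Complete.
Variable R : realType.

(** The lower bounds u n - e n are all below the upper bounds u m + e m. *)
Lemma real_cauchy_limit (u e : nat -> R) : (forall n, 0 <= e n) ->
  (forall n m, (n <= m)%N -> `|u m - u n| <= e n) ->
  exists l, forall n, `|l - u n| <= e n.
Proof.
move=> e0 ue; pose S := [set u n - e n | n in [set: nat]].
have ub n m : u n - e n <= u m + e m.
  have [nm|/ltnW mn] := leqP n m.
    have := ue _ _ nm; have := e0 m; rewrite ler_norml => ? /andP[]; lra.
  have := ue _ _ mn; have := e0 n; rewrite ler_norml => ? /andP[]; lra.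
have supS : has_sup S.
  split; first by exists (u 0 - e 0); exists 0.
  by exists (u 0 + e 0) => _ [n _ <-].
exists (sup S) => n; rewrite ler_norml.
have h1 : u n - e n <= sup S by apply: ub_le_sup; [case: supS|exists n].
have h2 : sup S <= u n + e n by apply: ge_sup => [|_ [m _ <-]//]; case: supS.
lra.
Qed.

Lemma normc_Re (z : R[i]) : `|complex.Re z| <= normc z.
Proof.
case: z => a b /=; rewrite -sqrtr_sqr ler_wsqrtr// lerDl sqr_ge0//.
Qed.

Lemma normc_Im (z : R[i]) : `|complex.Im z| <= normc z.
Proof.
case: z => a b /=; rewrite -sqrtr_sqr ler_wsqrtr// lerDr sqr_ge0//.
Qed.

Lemma normc_le_ReIm (z : R[i]) : normc z <= `|complex.Re z| + `|complex.Im z|.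
Proof.
case: z => a b /=; rewrite -[leRHS]ger0_norm ?addr_ge0// -sqrtr_sqr.
rewrite ler_wsqrtr// sqrrD !real_normK ?num_real//.
by rewrite addrAC lerDl mulrn_wge0// mulr_ge0.
Qed.

Lemma complex_cauchy_limit (u : nat -> R[i]) (e : nat -> R) :
  (forall n, 0 <= e n) ->
  (forall n m, (n <= m)%N -> normc (u m - u n) <= e n) ->
  exists l, forall n, normc (l - u n) <= 2 * e n.
Proof.
move=> e0 ue.
have [n m nm|a ha] := @real_cauchy_limit (fun n => complex.Re (u n)) e e0.
  apply: le_trans (ue _ _ nm); apply: le_trans (normc_Re _).
  by case: (u m) (u n) => ? ? [].
have [n m nm|b hb] := @real_cauchy_limit (fun n => complex.Im (u n)) e e0.
  apply: le_trans (ue _ _ nm); apply: le_trans (normc_Im _).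
  by case: (u m) (u n) => ? ? [].
exists (a +i* b)%C => n; apply: le_trans (normc_le_ReIm _) _.
by have := ha n; have := hb n; case: (u n) => c d /=; lra.
Qed.

Variable I : choiceType.
Local Notation H := (l2 R I).

(** The sequence e bounds the distance to the tail, and the limit satisfies
    the same bounds, which keeps the estimates explicit later on. On a finite
    set of coordinates the limit is compared with x m for m large, all
    coordinates of x m being uniformly close to those of the limit. *)
Lemma l2_complete (x : nat -> H) (e : nat -> R) : (forall n, 0 <= e n) ->
  (forall d : R, 0 < d -> exists n, forall m, (n <= m)%N -> e m <= d) ->
  (forall n m, (n <= m)%N -> l2_norm (x m - x n) <= e n) ->
  exists y, forall n, l2_norm (y - x n) <= e n.
Proof.
move=> e0 elim xe.
have [l hl] := choice (fun i => complex_cauchy_limit (u := fun n => x n i) e0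
  (fun n m nm => le_trans (l2_coord_le (x m - x n) i) (xe n m nm))).
have bound n (A : {fset I}) : \sum_(i <- A) normc (l i - x n i) ^+ 2 <= e n ^+ 2.
  set S := \sum_(i <- A) _; have S0 : 0 <= S by apply: sumr_ge0 => i _; exact: sqr_ge0.
  rewrite -(sqr_sqrtr S0) lerXn2r ?nnegrE ?sqrtr_ge0//.
  apply/ler_addgt0Pr => d d0.
  (* As N is at least 1, the norm of |A| coordinates off by 2 e m is at most
     2 e m N. *)
  pose N : R := (#|` A|%:R : R) + 1.
  have N0 : 0 < N by rewrite ltr_wpDl.
  have [n0 hn0] := elim (d / (2 * N)) (divr_gt0 d0 (mulr_gt0 (ltr0Sn R 1) N0)).
  pose m := maxn n0 n.
  have em : 2 * e m * N <= d.
    have := hn0 m (leq_maxl _ _); rewrite ler_pdivlMr ?mulr_gt0//; lra.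
  have tail : \sum_(i <- A) normc (l i - x m i) ^+ 2 <= (2 * e m * N) ^+ 2.
    apply: (@le_trans _ _ (\sum_(i <- A) (2 * e m) ^+ 2)).
      apply: ler_sum => i _; rewrite lerXn2r ?nnegrE ?normc_ge0 ?mulr_ge0//; exact: hl.
    rewrite [leRHS]exprMn (_ : bigop _ _ _ = (2 * e m) ^+ 2 * #|` A|%:R); last first.
      by rewrite big_const_seq count_predT iter_addr addr0 mulr_natr.
    apply: ler_wpM2l; first exact: sqr_ge0.
    apply: (@le_trans _ _ N); first by rewrite /N lerDl.
    by rewrite expr2 ler_peMl ?(ltW N0)// /N lerDr.
  have head := l2_normP (e0 n) (xe n m (leq_maxr _ _)) A.
  have em0 : 0 <= 2 * e m * N by rewrite !mulr_ge0// ltW.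
  have := finite_minkowski (e0 n) em0 head tail.
  move=> mink; apply: le_trans (lerD (lexx _) em).
  rewrite -[leRHS]ger0_norm ?addr_ge0// -sqrtr_sqr ler_wsqrtr//.
  apply: le_trans mink; apply: ler_sum => i _.
  rewrite lerXn2r ?nnegrE ?addr_ge0 ?normc_ge0//.
  rewrite (_ : l i - x n i = (x m - x n) i + (l i - x m i)); first exact: le_normcD.
  by rewrite l2D l2N; ring.
have sq0 : (fun i => l i - x 0 i : R[i]^o) \in square_summable (R := R) (I := I).
  by apply/square_summableP; exists (e 0 ^+ 2) => A; exact: bound.
exists (MkL2 sq0 + x 0) => n; apply: l2_norm_le => // A.
apply: le_trans (bound n A); apply: ler_sum => i _.
by rewrite !l2D l2N /= subrK.
Qed.

End Complete.

Section HasSum.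
Variables (R : realType) (I : choiceType).
Implicit Types (f g : I -> R[i]) (s t : R[i]).
Local Open Scope fset_scope.

(** The value of summability.sum, in a form free of filters and of complex
    tolerances. *)
Definition has_sum f s := forall e : R, 0 < e -> exists A0 : {fset I},
  forall A : {fset I}, A0 `<=` A -> normc (s - \sum_(i <- A) f i)%R < e.

Lemma has_sumD f g s t : has_sum f s -> has_sum g t ->
  has_sum (fun i => f i + g i)%R (s + t)%R.
Proof.
move=> fs gt e e0; have e20 : 0 < e / 2 by rewrite divr_gt0.
have [A fA] := fs _ e20; have [B gB] := gt _ e20.
exists (A `|` B) => C; rewrite fsubUset => /andP[AC BC].
rewrite big_split /= opprD addrACA; apply: le_lt_trans (le_normcD _ _) _.
by have := fA _ AC; have := gB _ BC; lra.
Qed.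

Lemma normc_eq0 (z : R[i]) : (normc z == 0) = (z == 0).
Proof. by apply/eqP/eqP => [/eq0_normc|->]; rewrite ?normc0. Qed.

Lemma normc_gt0 (z : R[i]) : (0 < normc z) = (z != 0).
Proof. by rewrite lt_neqAle normc_ge0 andbT eq_sym normc_eq0. Qed.

Lemma has_sumZ f s (c : R[i]) : has_sum f s -> has_sum (fun i => c * f i)%R (c * s)%R.
Proof.
have [->|c0] := eqVneq c 0%R.
  move=> _ e e0; exists fset0 => A _; rewrite mul0r big1 ?subr0 ?normc0//.
  by move=> i _; rewrite mul0r.
move=> fs e e0; have nc0 : 0 < normc c by rewrite normc_gt0.
have [A fA] := fs _ (divr_gt0 e0 nc0); exists A => B AB.
by rewrite -mulr_sumr -mulrBr normcM mulrC -ltr_pdivlMr//; exact: fA.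
Qed.

Lemma has_sum_conj f s : has_sum f s -> has_sum (fun i => (f i)^*%C) s^*%C.
Proof.
move=> fs e e0; have [A fA] := fs _ e0; exists A => B /fA.
rewrite -rmorph_sum -rmorphB.
by case: (_ - _)%R => a b /=; rewrite sqrrN.
Qed.

Lemma has_sum_unique f s t : has_sum f s -> has_sum f t -> s = t.
Proof.
move=> fs ft; apply/eqP; rewrite -subr_eq0 -normc_eq0 eq_le normc_ge0 andbT.
apply/ler_addgt0Pr => e e0; rewrite add0r; have e20 : 0 < e / 2 by rewrite divr_gt0.
have [A fA] := fs _ e20; have [B gB] := ft _ e20.
have hA := fA _ (fsubsetUl A B); have hB := gB _ (fsubsetUr A B).
set S := (\sum_(i <- A `|` B) f i)%R in hA hB.
rewrite (_ : s - t = (s - S) + (- (t - S)))%R; last by ring.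
apply: le_trans (le_normcD _ _) _; rewrite normcN; lra.
Qed.

Lemma has_sum_bound f s (M : R) :
  (forall A : {fset I}, normc (\sum_(i <- A) f i)%R <= M) -> has_sum f s -> normc s <= M.
Proof.
move=> fM fs; apply/ler_addgt0Pr => e e0; have [A fA] := fs _ e0.
have := fA A (fsubset_refl A); have := fM A; set S := (\sum_(i <- A) f i)%R => h1 h2.
rewrite -(subrK S s); apply: le_trans (le_normcD _ _) _; lra.
Qed.

Lemma has_sum_nonneg (g : I -> R) (M : R) : (forall i, 0 <= g i) ->
  (forall A : {fset I}, (\sum_(i <- A) g i)%R <= M) ->
  exists2 s : R, has_sum (fun i => (g i)%:C%C) s%:C%C &
    forall A : {fset I}, (\sum_(i <- A) g i)%R <= s.
Proof.
move=> g0 gM; pose S := [set (\sum_(i <- A) g i)%R | A in [set: {fset I}]]%classic.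
have supS : has_sup S.
  split; first by exists (\sum_(i <- fset0) g i)%R; exists fset0.
  by exists M => _ [A _ <-].
have ub A : (\sum_(i <- A : {fset I}) g i)%R <= sup S.
  by apply: ub_le_sup; [case: supS|exists A].
exists (sup S) => // e e0; have [_ [A _ <-] hA] := sup_adherent e0 supS.
exists A => B AB; rewrite -rmorph_sum -rmorphB /= expr0n addr0 sqrtr_sqr.
have AleB : (\sum_(i <- A) g i <= \sum_(i <- B) g i)%R.
  rewrite [leRHS](big_fsetID _ (mem A)) /=.
  rewrite [X in (X + _)%R](_ : _ = \sum_(i <- A) g i)%R; last first.
    apply: eq_fbigl => i; rewrite !inE /= andbC; case: (boolP (i \in A)) => //= iA.
    by rewrite (fsubsetP AB).
  by rewrite lerDl sumr_ge0.
by rewrite ger0_norm ?subr_ge0//; have := ub B; lra.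
Qed.

(** Absolute convergence reduces to nonnegative terms: the real part is the
    difference of |f| + Re f and |f|, and likewise for the imaginary part. *)
Lemma has_sum_exists f (M : R) :
  (forall A : {fset I}, (\sum_(i <- A) normc (f i))%R <= M) -> exists s, has_sum f s.
Proof.
move=> fM.
have part (p : R[i] -> R) : (forall z, `|p z| <= normc z) ->
    exists s, has_sum (fun i => (p (f i))%:C%C) s.
  move=> pn.
  have [|s hs _] := @has_sum_nonneg (fun i => normc (f i)) M _ fM.
    by move=> i; exact: normc_ge0.
  have [||t ht _] := @has_sum_nonneg (fun i => normc (f i) + p (f i))%R (M + M)%R.
  - by move=> i; have := pn (f i); rewrite ler_norml => /andP[]; lra.
  - move=> A; apply: le_trans (lerD (fM A) (fM A)); rewrite -big_split /=.
    by apply: ler_sum => i _; rewrite lerD2l; exact: le_trans (ler_norm _) (pn _).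
  exists (t%:C%C + (-1) * s%:C%C)%R; have := has_sumD ht (has_sumZ (-1)%R hs).
  congr has_sum; apply/funext => i.
  by rewrite rmorphD /= mulN1r addrAC subrr add0r.
have [s hs] := part _ (@normc_Re R); have [t ht] := part _ (@normc_Im R).
exists (s + 'i%C * t)%R; have := has_sumD hs (has_sumZ 'i%C ht).
by congr has_sum; apply/funext => i; rewrite -complexE.
Qed.

Lemma has_sum_summability f s : has_sum f s ->
  @summability.sum I R[i] R[i]^o f = s.
Proof.
move=> fs; have FT := @summability.totally_filter I.
apply/cvg_lim; first exact: norm_hausdorff.
apply/cvgrPdist_lt => e e0.
have eE : e = (complex.Re e)%:C%C by rewrite RRe_real// ger0_real// ltW.
have re0 : 0 < complex.Re e by move: e0; rewrite eE ltcR.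
have [A fA] := fs _ re0; exists A => // B /= AB.
rewrite eE /summability.partial_sum -(big_seq_fsetE _ _ predT (fun i => f i)) /=.
by have := fA B AB; rewrite -ltcR.
Qed.

End HasSum.

(** * The inner product and bounded operators *)

Section Dot.
Variables (R : realType) (I : choiceType).
Local Notation H := (l2 R I).
Implicit Types (x y z : H).

Lemma normc_conj (z : R[i]) : normc z^*%C = normc z.
Proof. by case: z => a b /=; rewrite sqrrN. Qed.

Lemma conjcM (a b : R[i]) : (a * b)^*%C = a^*%C * b^*%C.
Proof. exact: (rmorphM (@conjc R)). Qed.

Lemma conjcD (a b : R[i]) : (a + b)^*%C = a^*%C + b^*%C.
Proof. exact: (rmorphD (@conjc R)). Qed.

Lemma conjcN1 : (-1)^*%C = -1 :> R[i].
Proof. exact: (rmorphN1 (@conjc R)). Qed.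

Lemma normc_sum (s : seq I) (f : I -> R[i]) :
  normc (\sum_(i <- s) f i) <= \sum_(i <- s) normc (f i).
Proof.
elim: s => [|i s IH]; first by rewrite !big_nil normc0.
by rewrite !big_cons; apply: le_trans (le_normcD _ _) _; rewrite lerD2l.
Qed.

Lemma dot_abs_bound x y (A : {fset I}) :
  \sum_(i <- A) normc ((x i : R[i]) * (y i)^*%C) <= l2_norm x * l2_norm y.
Proof.
under eq_bigr do rewrite normcM normc_conj.
by apply: finite_cauchy_schwarz; rewrite ?l2_norm_ge0 ?l2_norm_ge.
Qed.

Lemma dot_has_sum x y : has_sum (fun i => (x i : R[i]) * (y i)^*%C) (l2_dot x y).
Proof.
have [s hs] := has_sum_exists (dot_abs_bound x y).
by rewrite /l2_dot (has_sum_summability hs).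
Qed.

Lemma dot_eq x y (s : R[i]) :
  has_sum (fun i => (x i : R[i]) * (y i)^*%C) s -> l2_dot x y = s.
Proof. by move=> hs; apply: has_sum_unique (dot_has_sum x y) hs. Qed.

Lemma dotDl x y z : l2_dot (x + y) z = l2_dot x z + l2_dot y z.
Proof.
apply: dot_eq; have := has_sumD (dot_has_sum x z) (dot_has_sum y z).
by congr has_sum; apply/funext => i; rewrite l2D mulrDl.
Qed.

Lemma dotZl (c : R[i]) x z : l2_dot (c *: x) z = c * l2_dot x z.
Proof.
apply: dot_eq; have := has_sumZ c (dot_has_sum x z).
by congr has_sum; apply/funext => i; rewrite l2Z mulrA.
Qed.

Lemma dotC x y : l2_dot y x = (l2_dot x y)^*%C.
Proof.
apply: dot_eq; have := has_sum_conj (dot_has_sum x y).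
by congr has_sum; apply/funext => i; rewrite conjcM conjcK mulrC.
Qed.

Lemma dotDr x y z : l2_dot z (x + y) = l2_dot z x + l2_dot z y.
Proof. by rewrite dotC dotDl conjcD -!dotC. Qed.

Lemma dotZr (c : R[i]) x z : l2_dot z (c *: x) = c^*%C * l2_dot z x.
Proof. by rewrite dotC dotZl conjcM -dotC. Qed.

Lemma dotBl x y z : l2_dot (x - y) z = l2_dot x z - l2_dot y z.
Proof. by rewrite dotDl -scaleN1r dotZl mulN1r. Qed.

Lemma dotBr x y z : l2_dot z (x - y) = l2_dot z x - l2_dot z y.
Proof. by rewrite dotDr -scaleN1r dotZr conjcN1 mulN1r. Qed.

Lemma dot_cauchy_schwarz x y : normc (l2_dot x y) <= l2_norm x * l2_norm y.
Proof.
apply: has_sum_bound (dot_has_sum x y) => A.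
by apply: le_trans (normc_sum _ _) _; exact: dot_abs_bound.
Qed.

(** The sum exceeds all finite sums of squares, hence the squared norm, and
    the Cauchy-Schwarz inequality gives the other bound. *)
Lemma dot_self x : l2_dot x x = (l2_norm x ^+ 2)%:C%C.
Proof.
have [||s hs sge] := @has_sum_nonneg _ I (fun i => normc (x i) ^+ 2) (l2_norm x ^+ 2).
- by move=> i; exact: sqr_ge0.
- by move=> A; exact: l2_norm_ge.
have e : l2_dot x x = s%:C%C.
  apply: dot_eq; move: hs; congr has_sum; apply/funext => i.
  by rewrite -sqr_normc rmorphXn.
have s0 : 0 <= s by have := sge fset0; rewrite big_seq_fset0.
have up : l2_norm x ^+ 2 <= s.
  rewrite -(sqr_sqrtr s0) lerXn2r ?nnegrE ?sqrtr_ge0 ?l2_norm_ge0//.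
  by apply: l2_norm_le => [|A]; rewrite ?sqrtr_ge0// sqr_sqrtr.
have := dot_cauchy_schwarz x x; rewrite e /= expr0n addr0 sqrtr_sqr ger0_norm// -expr2.
by move=> dn; congr (_%:C%C); apply/eqP; rewrite eq_le dn.
Qed.

Definition l2_delta (p : I) : H := to_l2 (fun i => (i == p)%:R).

Lemma l2_deltaE p i : l2_delta p i = (i == p)%:R.
Proof.
rewrite /l2_delta /to_l2 insubdK//; apply/square_summableP; exists 1 => A.
have [pA|pA] := boolP (p \in A).
  rewrite (big_fsetD1 p)//= eqxx normc1 expr1n big_seq big1 ?addr0// => j.
  by rewrite in_fsetD1 => /andP[/negPf-> _]; rewrite normc0 expr0n.
rewrite big_seq big1// => j jA; case: eqP => [jp|_]; last by rewrite normc0 expr0n.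
by rewrite -jp jA in pA.
Qed.

Lemma dot_delta x p : l2_dot x (l2_delta p) = x p.
Proof.
apply: dot_eq => e e0; exists [fset p]%fset => A; rewrite fsub1set => pA.
rewrite (big_fsetD1 p)//= l2_deltaE eqxx conjc1 mulr1 big_seq big1 ?addr0 ?subrr ?normc0//.
by move=> j; rewrite in_fsetD1 l2_deltaE => /andP[/negPf-> _]; rewrite conjc0 mulr0.
Qed.

Lemma l2_norm_delta p : l2_norm (l2_delta p) = 1.
Proof.
have := dot_self (l2_delta p); rewrite dot_delta l2_deltaE eqxx => /(congr1 (@complex.Re R)) /= h.
by apply/eqP; rewrite -(@eqrXn2 _ 2) ?l2_norm_ge0// expr1n -h.
Qed.

Lemma l2_norm_small_eq0 x : (forall e : R, 0 < e -> l2_norm x <= e) -> x = 0.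
Proof.
move=> h; apply: l2_norm0_eq; apply/eqP; rewrite eq_le l2_norm_ge0 andbT.
by apply/ler_addgt0Pr => e /h; rewrite add0r.
Qed.

End Dot.

Section Operators.
Variables (R : realType) (I : choiceType).
Local Notation H := (l2 R I).
Implicit Types (x y : H) (S T : H -> H) (A : set (H -> H)).

(** A bound on the norm that avoids the supremum defining operator_norm. *)
Definition opbound T (M : R) := forall x, l2_norm (T x) <= M * l2_norm x.

Lemma opDE S T x : (S + T) x = S x + T x. Proof. by []. Qed.
Lemma opNE T x : (- T) x = - T x. Proof. by []. Qed.
Lemma opBE S T x : (S - T) x = S x - T x. Proof. by []. Qed.
Lemma opZE (c : R[i]) T x : (c *: T) x = c *: T x. Proof. by []. Qed.

Lemma opbound_le T (M N : R) : M <= N -> opbound T M -> opbound T N.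
Proof. by move=> MN TM x; apply: le_trans (TM x) _; rewrite ler_wpM2r ?l2_norm_ge0. Qed.

Lemma opboundD S T (M N : R) : opbound S M -> opbound T N -> opbound (S + T) (M + N).
Proof.
by move=> SM TN x; apply: le_trans (l2_norm_triangle _ _) _; rewrite mulrDl lerD.
Qed.

Lemma opboundZ (c : R[i]) T (M : R) : opbound T M -> opbound (c *: T) (normc c * M).
Proof. by move=> TM x; rewrite l2_normZ -mulrA ler_wpM2l ?normc_ge0. Qed.

Lemma opbound_comp S T (M N : R) : 0 <= M -> opbound S M -> opbound T N ->
  opbound (S \o T) (M * N).
Proof.
by move=> M0 SM TN x /=; apply: le_trans (SM _) _; rewrite -mulrA ler_wpM2l.
Qed.

Lemma opbound_nonneg T : (exists M, opbound T M) -> exists2 M, 0 <= M & opbound T M.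
Proof.
move=> [M TM]; exists `|M|; first exact: normr_ge0.
exact: opbound_le (ler_norm _) TM.
Qed.

Lemma linear_opD T x y : linear T -> T (x + y) = T x + T y.
Proof. by move=> lT; rewrite -{1}(scale1r x) lT scale1r. Qed.

Lemma linear_op0 T : linear T -> T 0 = 0.
Proof. by move=> lT; have := lT (-1) 0 0; rewrite scaler0 addr0 scaleN1r addNr. Qed.

Lemma linear_opZ T x (c : R[i]) : linear T -> T (c *: x) = c *: T x.
Proof. by move=> lT; rewrite -[c *: x]addr0 lT linear_op0// addr0. Qed.

Lemma linear_opB T x y : linear T -> T (x - y) = T x - T y.
Proof. by move=> lT; rewrite linear_opD// -scaleN1r linear_opZ// scaleN1r. Qed.

Lemma bounded_op0 : bounded_operator (0 : H -> H).
Proof.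
split=> [c x y|]; first by rewrite /= scaler0 addr0.
by exists 0 => x; rewrite l2_norm0 mul0r.
Qed.

Lemma bounded_op_id : bounded_operator (id : H -> H).
Proof. by split=> [c x y //|]; exists 1 => x; rewrite mul1r. Qed.

Lemma bounded_opD S T : bounded_operator S -> bounded_operator T ->
  bounded_operator (S + T).
Proof.
move=> [lS [M SM]] [lT [N TN]]; split; last by exists (M + N); exact: opboundD.
by move=> c x y; rewrite !opDE lS lT scalerDr addrACA.
Qed.

Lemma bounded_opZ (c : R[i]) T : bounded_operator T -> bounded_operator (c *: T).
Proof.
move=> [lT [M TM]]; split; last by exists (normc c * M); exact: opboundZ.
by move=> d x y; rewrite !opZE lT scalerDr !scalerA mulrC.
Qed.

Lemma bounded_op_comp S T : bounded_operator S -> bounded_operator T ->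
  bounded_operator (S \o T).
Proof.
move=> [lS bS] [lT bT]; split=> [c x y|]; first by rewrite /= lT lS.
have [M M0 SM] := opbound_nonneg bS; have [N N0 TN] := opbound_nonneg bT.
by exists (M * N); exact: opbound_comp.
Qed.

Lemma opbound_operator_norm T : bounded_operator T -> opbound T (operator_norm T).
Proof.
move=> [lT bT]; have [M M0 TM] := opbound_nonneg bT => x.
set S := [set l2_norm (T y) | y in [set y | l2_norm y <= 1]].
have supS : has_sup S.
  split; first by exists (l2_norm (T 0)); exists 0 => //=; rewrite l2_norm0.
  exists M => _ [y /= y1 <-]; apply: le_trans (TM y) _.
  by rewrite -[leRHS]mulr1 ler_wpM2l.
have [x0|x0] := eqVneq (l2_norm x) 0.
  by rewrite (l2_norm0_eq x0) linear_op0// !l2_norm0 mulr0.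
have xp : 0 < l2_norm x by rewrite lt_neqAle l2_norm_ge0 eq_sym x0.
pose c : R[i] := ((l2_norm x)^-1)%:C%C.
have nc : normc c = (l2_norm x)^-1.
  by rewrite /= expr0n addr0 sqrtr_sqr ger0_norm// invr_ge0 ltW.
have : S (l2_norm (T (c *: x))) by exists (c *: x) => //=; rewrite l2_normZ nc mulVf.
move=> /(ub_le_sup supS.2); rewrite linear_opZ// l2_normZ nc.
by rewrite ler_pdivrMl// mulrC.
Qed.

Lemma operator_norm_le T (M : R) : 0 <= M -> opbound T M -> operator_norm T <= M.
Proof.
move=> M0 TM; apply: ge_sup => [|_ [y /= y1 <-]].
  by exists (l2_norm (T 0)); exists 0 => //=; rewrite l2_norm0.
by apply: le_trans (TM y) _; rewrite -[leRHS]mulr1 ler_wpM2l.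
Qed.

Lemma norm_closure_approx A T (e : R) : (forall S, A S -> bounded_operator S) ->
  norm_closure A T -> 0 < e -> exists2 S, A S & opbound (T - S) e.
Proof.
move=> bA [bT apT] e0; have [S AS TS] := apT e e0; exists S => //.
apply: opbound_le (ltW TS) _; apply: opbound_operator_norm.
by rewrite -scaleN1r; apply/bounded_opD/bounded_opZ/bA.
Qed.

Lemma norm_closure_intro A T : bounded_operator T ->
  (forall e : R, 0 < e -> exists2 S, A S & opbound (T - S) e) -> norm_closure A T.
Proof.
move=> bT apT; split=> // e e0; have e20 : 0 < e / 2 by rewrite divr_gt0.
have [S AS TS] := apT _ e20; exists S => //.
by apply: le_lt_trans (operator_norm_le (ltW e20) TS) _; lra.
Qed.

End Operators.

(** * Adjoints, norm-closed algebras and their ideals *)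

Section Adjoints.
Variables (R : realType) (I : choiceType).
Local Notation H := (l2 R I).
Implicit Types (x y : H) (S T : H -> H).

Lemma adjoint_sym S T : is_adjoint S T -> is_adjoint T S.
Proof. by move=> ST x y; rewrite dotC -ST -dotC. Qed.

Lemma adjointD S T S' T' : is_adjoint S S' -> is_adjoint T T' ->
  is_adjoint (S + T) (S' + T').
Proof. by move=> SS TT x y; rewrite dotDl dotDr SS TT. Qed.

Lemma adjointZ (c : R[i]) T T' : is_adjoint T T' -> is_adjoint (c *: T) (c^*%C *: T').
Proof. by move=> TT x y; rewrite dotZl dotZr conjcK TT. Qed.

Lemma adjoint_comp S T S' T' : is_adjoint S S' -> is_adjoint T T' ->
  is_adjoint (S \o T) (T' \o S').
Proof. by move=> SS TT x y; rewrite /= SS TT. Qed.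

Lemma adjoint0 : is_adjoint (0 : H -> H) 0.
Proof.
move=> x y.
have z w : l2_dot (0 : H) w = 0 by rewrite -[0 : H](scale0r 0) dotZl mul0r.
by rewrite [RHS]dotC !z conjc0.
Qed.

Lemma adjoint_id : is_adjoint (id : H -> H) id. Proof. by []. Qed.

(** By the Cauchy-Schwarz inequality, <S x, y> - <x, T y> changes by at most
    2 e |x| |y| when S and T are replaced by S' and T'. *)
Lemma adjoint_limit S T :
  (forall e : R, 0 < e -> exists S' T', [/\ is_adjoint S' T',
     opbound (S - S') e & opbound (T - T') e]) -> is_adjoint S T.
Proof.
move=> h x y; apply/eqP; rewrite -subr_eq0 -normc_eq0 eq_le normc_ge0 andbT.
apply/ler_addgt0Pr => e e0; rewrite add0r.
pose N := 1 + 2 * (l2_norm x * l2_norm y).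
have xy0 : 0 <= l2_norm x * l2_norm y by rewrite mulr_ge0 ?l2_norm_ge0.
have N0 : 0 < N by rewrite ltr_pwDl// mulr_ge0.
have [S' [T' [ST SS TT]]] := h _ (divr_gt0 e0 N0).
have -> : l2_dot (S x) y - l2_dot x (T y) =
    l2_dot ((S - S') x) y + - l2_dot x ((T - T') y) :> R[i].
  by rewrite dotBl dotBr ST; ring.
apply: le_trans (le_normcD _ _) _; rewrite normcN.
have d0 : 0 < e / N by rewrite divr_gt0.
have h1 : normc (l2_dot ((S - S') x) y) <= e / N * (l2_norm x * l2_norm y).
  apply: le_trans (dot_cauchy_schwarz _ _) _.
  by rewrite mulrA ler_wpM2r ?l2_norm_ge0.
have h2 : normc (l2_dot x ((T - T') y)) <= e / N * (l2_norm x * l2_norm y).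
  apply: le_trans (dot_cauchy_schwarz _ _) _.
  by rewrite mulrCA ler_wpM2l ?l2_norm_ge0.
have dN : e / N * N = e by rewrite divfK// gt_eqF.
apply: le_trans (lerD h1 h2) _; rewrite -[leRHS]dN {4}/N; lra.
Qed.

End Adjoints.

Section OperatorAlgebra.
Variables (R : realType) (I : choiceType).
Local Notation H := (l2 R I).
Implicit Types (x y : H) (S T : H -> H) (A : set (H -> H)).

Record operator_algebra A : Prop := {
  opalg_bounded : forall T, A T -> bounded_operator T;
  opalg_id : A id;
  opalgD : forall S T, A S -> A T -> A (S + T);
  opalgZ : forall (c : R[i]) T, A T -> A (c *: T);
  opalgM : forall S T, A S -> A T -> A (S \o T) }.

Lemma subsub_opbound S T S' (M N : R) :
  opbound (S - T) M -> opbound (T - S') N -> opbound (S - S') (M + N).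
Proof.
move=> ST TS x; rewrite mulrDl; apply: le_trans (lerD (ST x) (TS x)).
exact: (l2_dist_triangle (T x)).
Qed.

(** For products, S T - S' T' = (S - S') T + S' (T - T'). *)
Lemma norm_closure_algebra A : operator_algebra A -> operator_algebra (norm_closure A).
Proof.
move=> algA; have bA := opalg_bounded algA; have ap := norm_closure_approx bA.
split=> [T []//||S T /[dup] clS [bS _] /[dup] clT [bT _]
  |c T /[dup] clT [bT _]|S T /[dup] clS [bS _] /[dup] clT [bT _]].
- apply: norm_closure_intro; first exact: bounded_op_id.
  move=> e e0; exists id; first exact: opalg_id.
  by rewrite subrr => x; rewrite l2_norm0 mulr_ge0 ?l2_norm_ge0// ltW.
- apply: norm_closure_intro; first exact: bounded_opD.
  move=> e e0; have e20 : 0 < e / 2 by rewrite divr_gt0.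
  have [S' AS SS] := ap _ _ clS e20; have [T' AT TT] := ap _ _ clT e20.
  exists (S' + T'); first exact: opalgD.
  rewrite opprD addrACA; apply: opbound_le (opboundD SS TT); lra.
- apply: norm_closure_intro; first exact: bounded_opZ.
  move=> e e0; pose N := normc c + 1; have N0 : 0 < N by rewrite ltr_wpDl ?normc_ge0.
  have [T' AT TT] := ap _ _ clT (divr_gt0 e0 N0).
  exists (c *: T'); first exact: opalgZ.
  rewrite -scalerBr; apply: opbound_le (opboundZ c TT).
  by rewrite mulrCA ger_pMr// ler_pdivrMr// mul1r lerDl.
apply: norm_closure_intro; first exact: bounded_op_comp.
move=> e e0; have [M M0 TM] := opbound_nonneg bT.2.
have [N N0 SN] := opbound_nonneg bS.2.
pose d := Num.min 1 (e / (M + N + 1)).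
have D0 : 0 < M + N + 1 by rewrite ltr_wpDl// addr_ge0.
have d0 : 0 < d by rewrite lt_min ltr01 divr_gt0.
have [S' AS SS] := ap _ _ clS d0; have [T' AT TT] := ap _ _ clT d0.
exists (S' \o T'); first exact: opalgM.
have lS := bS.1.
have de : d * (M + N + 1) <= e by rewrite -ler_pdivlMr// ge_min lexx orbT.
have d1 : d <= 1 by rewrite ge_min lexx.
have S'N : opbound S' (N + d).
  move=> x; rewrite -[S' x](subKr (S x)); apply: le_trans (l2_normB _ _) _.
  by rewrite mulrDl lerD//; exact: SS.
have Nd0 : 0 <= N + d by rewrite addr_ge0// ltW.
have [lS' _] := bA _ AS.
have split x : ((S \o T) - (S' \o T')) x = (S - S') (T x) + S' ((T - T') x).
  by rewrite !opBE (linear_opB _ _ lS') /= addrA subrK.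
move=> x; rewrite split; apply: le_trans (l2_norm_triangle _ _) _.
have h1 := le_trans (SS (T x)) (ler_wpM2l (ltW d0) (TM x)).
have h2 := le_trans (S'N ((T - T') x)) (ler_wpM2l Nd0 (TT x)).
apply: le_trans (lerD h1 h2) _; rewrite !mulrA -mulrDl.
rewrite ler_wpM2r ?l2_norm_ge0//; apply: le_trans de; nra.
Qed.

Lemma norm_closure_closed A : operator_algebra A ->
  norm_closure (norm_closure A) `<=` norm_closure A.
Proof.
move=> algA T clT; have bA := opalg_bounded algA.
apply: norm_closure_intro; first by case: clT.
move=> e e0; have e20 : 0 < e / 2 by rewrite divr_gt0.
have [S clS TS] := norm_closure_approx (fun S (h : norm_closure A S) => h.1) clT e20.
have [S' AS SS] := norm_closure_approx bA clS e20.
exists S' => //; apply: opbound_le (subsub_opbound TS SS); lra.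
Qed.

Lemma norm_closure_sub A : operator_algebra A -> A `<=` norm_closure A.
Proof.
move=> algA T AT; apply: norm_closure_intro; first exact: opalg_bounded AT.
move=> e e0; exists T => //.
by rewrite subrr => x; rewrite l2_norm0 mulr_ge0 ?l2_norm_ge0// ltW.
Qed.

(** The elements 1 - (1 - T)^n belong to the ideal and converge to 1. *)
Lemma ideal_near_id A J T : operator_algebra A -> closed_ideal A J ->
  J T -> opbound (id - T) (1 / 2) -> J id.
Proof.
move=> algA idJ JT Tid; apply: (ideal_closed idJ).
pose S := fix S n := if n is m.+1 then S m + (T - (T \o S m)) else 0.
have JS n : J (S n).
  elim: n => [|n IH]; first exact: ideal0 idJ.
  apply: (idealD idJ) => //; apply: (idealD idJ) => //; rewrite -scaleN1r.
  by apply: (idealZ idJ); apply: (idealMl idJ) => //; exact: (ideal_sub idJ).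
have SE n : opbound (id - S n) ((1 / 2) ^+ n).
  elim: n => [|n IH]; first by move=> x; rewrite expr0 mul1r /= subr0.
  have E x : (id - S n.+1) x = (id - T) ((id - S n) x).
    have [lT _] := opalg_bounded algA (ideal_sub idJ JT).
    by rewrite !opBE (linear_opB _ _ lT) /= opDE opBE /= opprD addrA.
  move=> x; rewrite E exprS; apply: le_trans (Tid _) _.
  by rewrite -[leRHS]mulrA; apply: ler_wpM2l (IH x); rewrite divr_ge0.
apply: norm_closure_intro; first exact: bounded_op_id.
move=> e e0.
have /cvgrPdist_lt /(_ e e0) [n _ hn] : (fun n => (1 / 2 : R) ^+ n) @ \oo --> (0 : R).
  by apply: cvg_expr; rewrite ger0_norm; lra.
exists (S n) => //; apply: opbound_le (SE n).
by have := hn n (leqnn n); rewrite sub0r normrN => /ltW; apply: le_trans; exact: ler_norm.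
Qed.

End OperatorAlgebra.

(** * Inverse square roots near the identity *)

Section InverseSquareRoot.
Variables (R : realType) (I : choiceType).
Local Notation H := (l2 R I).
Implicit Types (x y : H) (S T z w d : H -> H) (A : set (H -> H)).

Lemma adjointN T T' : is_adjoint T T' -> is_adjoint (- T) (- T').
Proof.
by move=> TT x y; rewrite !opNE -[- T x]scaleN1r -[- T' y]scaleN1r dotZl dotZr conjcN1 TT.
Qed.

Lemma opboundN T (M : R) : opbound T M -> opbound (- T) M.
Proof. by move=> TM x; rewrite opNE l2_normN. Qed.

Let half : R[i] := (2^-1)%:C%C.

Let half_normc : normc half = 2^-1.
Proof. by rewrite /= expr0n addr0 sqrtr_sqr ger0_norm. Qed.

Let half_twice (a : R[i]) : half * a + half * a = a.
Proof.
rewrite -mulrDl -rmorphD (_ : 2^-1 + 2^-1 = 1 :> R) ?rmorph1 ?mul1r//.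
by field.
Qed.

(** The fixed points z of this map are the solutions of
    (1 + z) (1 - d) (1 + z) = 1, since this equation expands to
    2 z = d + z d + d z + z d z - z z. *)
Definition picard d z : H -> H :=
  half *: (d + (z \o d) + (d \o z) + (z \o d \o z) - (z \o z)).

Lemma picard_adjoint d z : is_adjoint d d -> is_adjoint z z ->
  is_adjoint (picard d z) (picard d z).
Proof.
move=> dd zz.
have : is_adjoint (picard d z)
    (half^*%C *: (d + (d \o z) + (z \o d) + (z \o (d \o z)) - (z \o z))).
  apply/adjointZ/adjointD/adjointN/adjoint_comp => //.
  apply: adjointD; last by apply: adjoint_comp => //; exact: adjoint_comp.
  apply: adjointD; last exact: adjoint_comp.
  by apply: adjointD => //; exact: adjoint_comp.
by rewrite [half^*%C]conjc_real [d + _ + _]addrAC.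
Qed.

Lemma picard_opbound d z : opbound d (1 / 8) -> opbound z (1 / 2) ->
  opbound (picard d z) (1 / 2).
Proof.
move=> d8 z2; have p2 : 0 <= 1 / 2 :> R by lra.
have p8 : 0 <= 1 / 8 :> R by lra.
have p16 : 0 <= 1 / 2 * (1 / 8) :> R by lra.
have := opboundZ half (opboundD (opboundD (opboundD (opboundD d8
  (opbound_comp p2 z2 d8)) (opbound_comp p8 d8 z2))
  (opbound_comp p16 (opbound_comp p2 z2 d8) z2)) (opboundN (opbound_comp p2 z2 z2))).
by apply: opbound_le; rewrite half_normc; lra.
Qed.

(** The difference of the two values is a sum of products that contain z - w
    exactly once, the other factors being d, z or w. *)
Lemma picard_contract d z w (k : R) : 0 <= k ->
  linear d -> linear z -> linear w ->
  opbound d (1 / 8) -> opbound z (1 / 2) -> opbound w (1 / 2) ->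
  opbound (z - w) k -> opbound (picard d z - picard d w) (11 / 16 * k).
Proof.
move=> k0 ld lz lw d8 z2 w2 zw.
have -> : picard d z - picard d w = half *: (((z - w) \o d) + (d \o (z - w))
    + (z \o (d \o (z - w))) + ((z - w) \o (d \o w))
    - (z \o (z - w)) - ((z - w) \o w)).
  apply/funext => x; rewrite /picard -scalerBr !opZE; congr (_ *: _).
  rewrite !(opDE, opNE) /= !(opDE, opNE) !(linear_opB _ _ ld, linear_opB _ _ lz, linear_opB _ _ lw).
  apply: l2_ext => i; rewrite !(l2D, l2N).
  ring.
have p2 : 0 <= 1 / 2 :> R by lra.
have p8 : 0 <= 1 / 8 :> R by lra.
have := opboundZ half (opboundD (opboundD (opboundD (opboundD (opboundD
  (opbound_comp k0 zw d8) (opbound_comp p8 d8 zw))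
  (opbound_comp p2 z2 (opbound_comp p8 d8 zw)))
  (opbound_comp k0 zw (opbound_comp p8 d8 w2)))
  (opboundN (opbound_comp p2 z2 zw))) (opboundN (opbound_comp k0 zw w2))).
by apply: opbound_le; rewrite half_normc; lra.
Qed.

Lemma picard_mem A d z : operator_algebra A -> A d -> A z -> A (picard d z).
Proof.
move=> algA Ad Az; have M := opalgM algA; have D := opalgD algA; have Z := opalgZ algA.
apply: (Z); rewrite -scaleN1r.
exact: D (D _ _ (D _ _ (D _ _ Ad (M _ _ Az Ad)) (M _ _ Ad Az)) (M _ _ (M _ _ Az Ad) Az))
  (Z _ _ (M _ _ Az Az)).
Qed.

(** On the ball of radius 1/2, and for |d| <= 1/8, picard d is a contraction
    of ratio 11/16. Its iterates from 0 are self-adjoint elements of A; for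
    their limit z, the element 1 + z is the one sought. *)
Lemma inverse_square_root A d : operator_algebra A -> norm_closure A `<=` A ->
  A d -> is_adjoint d d -> opbound d (1 / 8) ->
  exists r : H -> H, [/\ A r, is_adjoint r r & r \o (id - d) \o r = id].
Proof.
move=> algA clA Ad dd d8.
have linA T : A T -> linear T by move=> /(opalg_bounded algA)[].
pose z n := iter n (picard d) 0.
have A0 : A 0 by rewrite -(scale0r id); apply/(opalgZ algA)/(opalg_id algA).
have Az n : A (z n).
  by elim: n => [//|n IH]; exact: picard_mem.
have zz n : is_adjoint (z n) (z n).
  by elim: n => [|n IH]; [exact: adjoint0|exact: picard_adjoint].
have z2 n : opbound (z n) (1 / 2).
  elim: n => [x|n IH]; last exact: picard_opbound.
  by rewrite l2_norm0 mulr_ge0 ?l2_norm_ge0//; lra.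
pose q : R := 11 / 16.
have q0 n : 0 <= q ^+ n by rewrite exprn_ge0// /q; lra.
have step n : opbound (z n.+1 - z n) (q ^+ n).
  elim: n => [|n IH].
    rewrite subr0; apply: opbound_le (z2 1); rewrite expr0; lra.
  rewrite exprS; exact: (picard_contract (q0 n) (linA _ Ad) (linA _ (Az n.+1))
    (linA _ (Az n)) d8 (z2 n.+1) (z2 n) IH).
(* As 16 / 5 = 1 / (1 - q), e n is the tail of the geometric series. *)
pose e n := 16 / 5 * q ^+ n.
have e0 n : 0 <= e n by rewrite mulr_ge0//; lra.
have tele n k : opbound (z (n + k)%N - z n) (e n - e (n + k)%N).
  elim: k => [|k IH].
    by rewrite addn0 !subrr => x; rewrite l2_norm0 mul0r.
  rewrite addnS; apply: opbound_le (subsub_opbound (step (n + k)%N) IH).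
  by rewrite /e exprS /q; lra.
have zcauchy n m : (n <= m)%N -> opbound (z m - z n) (e n).
  move=> nm; have := tele n (m - n)%N; rewrite subnKC//.
  by apply: opbound_le; rewrite gerBl.
have elim : forall c : R, 0 < c -> exists n, forall m, (n <= m)%N -> e m <= c.
  move=> c c0.
  have /cvgrPdist_lt /(_ _ (divr_gt0 c0 (ltr0Sn R 3))) [n _ hn] :
      (fun n => q ^+ n) @ \oo --> (0 : R).
    by apply: cvg_expr; rewrite ger0_norm /q; lra.
  exists n => m nm; have := hn m nm; rewrite /= sub0r normrN ger0_norm// /e; lra.
have lim x : exists y, forall n, l2_norm (y - z n x) <= e n * l2_norm x.
  apply: l2_complete => [n|c c0|n m nm]; first by rewrite mulr_ge0 ?l2_norm_ge0.
    have N0 : 0 < l2_norm x + 1 by rewrite ltr_wpDl ?l2_norm_ge0.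
    have [n hn] := elim _ (divr_gt0 c0 N0); exists n => m nm.
    have := hn m nm; rewrite ler_pdivlMr// mulrDr mulr1 => h.
    by have := e0 m; lra.
  by rewrite -opBE; exact: zcauchy.
have [zl hzl] := choice lim.
have zlP n : opbound (zl - z n) (e n) by move=> x; rewrite opBE.
have bzl : bounded_operator zl.
  split; last first.
    exists (e 0 + 1 / 2) => x; rewrite -[zl x](subrK (z 0 x)).
    apply: le_trans (l2_norm_triangle _ _) _; rewrite mulrDl lerD//; exact: z2.
  move=> a u v; apply/eqP; rewrite -subr_eq0; apply/eqP/l2_norm_small_eq0 => c c0.
  pose N := l2_norm (a *: u + v) + (normc a * l2_norm u + l2_norm v) + 1.
  have N0 : 0 < N by rewrite ltr_wpDl// !addr_ge0 ?mulr_ge0 ?l2_norm_ge0 ?normc_ge0.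
  have [n hn] := elim _ (divr_gt0 c0 N0).
  have -> : zl (a *: u + v) - (a *: zl u + zl v) =
      (zl - z n) (a *: u + v) - (a *: (zl - z n) u + (zl - z n) v).
    rewrite ![(zl - z n) _]opBE (linA _ (Az n)) scalerBr.
    by rewrite [a *: zl u - _ + _]addrACA -[- _ - z n v]opprD opprB addrA subrK.
  apply: le_trans (l2_normB _ _) _.
  apply: le_trans (lerD (zlP n _) (l2_norm_triangle _ _)) _; rewrite l2_normZ.
  have hu := ler_wpM2l (normc_ge0 a) (zlP n u); have hv := zlP n v.
  have := hn n (leqnn n); rewrite ler_pdivlMr// => h; apply: le_trans h.
  have := e0 n; rewrite /N; move: hu hv; rewrite mulrCA; lra.
have Azl : A zl.
  apply: clA; apply: norm_closure_intro => // c c0.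
  have [n hn] := elim c c0; exists (z n) => //.
  exact: opbound_le (hn n (leqnn n)) (zlP n).
have zzl : is_adjoint zl zl.
  apply: adjoint_limit => c c0; have [n hn] := elim c c0.
  have h := opbound_le (hn n (leqnn n)) (zlP n).
  by exists (z n), (z n).
have zl2 : opbound zl (1 / 2).
  move=> x; apply/ler_addgt0Pr => c c0.
  have N0 : 0 < l2_norm x + 1 by rewrite ltr_wpDl ?l2_norm_ge0.
  have [n hn] := elim _ (divr_gt0 c0 N0).
  have h1 := z2 n x; have h2 := zlP n x; rewrite opBE in h2.
  have := l2_norm_triangle (zl x - z n x) (z n x); rewrite subrK => h3.
  have := hn n (leqnn n); rewrite ler_pdivlMr// mulrDr mulr1; have := e0 n.
  lra.
have fixzl x : picard d zl x = zl x.
  apply/eqP; rewrite -subr_eq0; apply/eqP/l2_norm_small_eq0 => c c0.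
  have N0 : 0 < 2 * (l2_norm x + 1) by rewrite mulr_gt0// ltr_wpDl ?l2_norm_ge0.
  have [n hn] := elim _ (divr_gt0 c0 N0).
  have h1 := picard_contract (e0 n) (linA _ Ad) (linA _ Azl) (linA _ (Az n)) d8 zl2 (z2 n) (zlP n).
  have h2 : opbound (picard d (z n) - zl) (e n.+1).
    by rewrite -opprB; apply: opboundN; exact: zlP n.+1.
  have h := subsub_opbound h1 h2.
  rewrite -[picard d zl x - zl x]/((picard d zl - zl) x).
  apply: le_trans (h x) _; have := hn n (leqnn n); have := hn n.+1 (leqnSn n).
  rewrite !ler_pdivlMr//; have := e0 n; have := e0 n.+1; have := l2_norm_ge0 x.
  by move: (e n) (e n.+1) (l2_norm x) => a b p; nra.
exists (id + zl); split.
- by apply: (opalgD algA) => //; exact: (opalg_id algA).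
- exact: adjointD.
apply/funext => x.
have -> : ((id + zl) \o (id - d) \o (id + zl)) x =
    (x + zl x - d (x + zl x)) + zl (x + zl x - d (x + zl x)) by [].
rewrite (linear_opB _ _ (linA _ Azl)) (linear_opD _ _ (linA _ Ad)).
rewrite !(linear_opD _ _ (linA _ Azl)).
have fx := fixzl x; apply: l2_ext => i.
have fxi : picard d zl x i = zl x i by rewrite fx.
rewrite /picard opZE l2Z !(opDE, opNE) !(l2D, l2N) /= in fxi.
have := half_twice (d x i + zl (d x) i + d (zl x) i + zl (d (zl x)) i - zl (zl x) i).
rewrite fxi => h; rewrite !(l2D, l2N).
by rewrite -[RHS](addrK (zl x i + zl x i)) {2}h; ring.
Qed.

End InverseSquareRoot.

(** * Finitely supported vectors *)

Section Density.
Variables (R : realType) (I : choiceType).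
Local Notation H := (l2 R I).

Lemma l2_sum_apply (J : Type) (s : seq J) (F : J -> H) i :
  (\sum_(j <- s) F j) i = \sum_(j <- s) (F j i : R[i]).
Proof. by elim/big_ind2: _ => // x a y b <- <-. Qed.

Lemma op_sum_apply (J : Type) (s : seq J) (F : J -> H -> H) x :
  (\sum_(j <- s) F j) x = \sum_(j <- s) F j x.
Proof. by elim/big_ind2: _ => // S a T b <- <-. Qed.

(** A finite set almost achieving the supremum of the finite sums of squares
    leaves little for the other coordinates. *)
Lemma l2_finite_support_dense (x : H) (e : R) : 0 < e ->
  exists A : {fset I}, l2_norm (x - \sum_(p <- A) (x p : R[i]) *: l2_delta R p) <= e.
Proof.
move=> e0.
pose S := [set (\sum_(i <- A) normc (x i) ^+ 2) | A in [set: {fset I}]].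
have supS : has_sup S.
  split; first by exists (\sum_(i <- fset0) normc (x i) ^+ 2); exists fset0.
  by exists (l2_norm x ^+ 2) => _ [A _ <-]; exact: l2_norm_ge.
have [_ [A _ <-] hA] := sup_adherent (exprn_gt0 2 e0) supS.
exists A; apply: l2_norm_le => [|B]; first exact: ltW.
have coord i : (x - \sum_(p <- A) (x p : R[i]) *: l2_delta R p) i =
    if i \in A then 0 else x i.
  rewrite l2D l2N l2_sum_apply.
  under eq_bigr do rewrite l2Z l2_deltaE.
  case: ifPn => iA.
    rewrite (big_fsetD1 i)//= eqxx mulr1 big_seq big1 ?addr0 ?subrr// => j.
    by rewrite in_fsetD1 eq_sym => /andP[/negPf-> _]; rewrite mulr0.
  rewrite big_seq big1 ?subr0// => j jA.
  by case: eqP => [ij|_]; rewrite ?mulr0//; rewrite ij jA in iA.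
under eq_bigr do rewrite coord.
have : \sum_(i <- (A `|` B)%fset) normc (x i) ^+ 2 <= sup S.
  by apply: ub_le_sup; [case: supS|exists (A `|` B)%fset].
rewrite (big_fsetID _ (mem A)) /=.
rewrite [X in X + _](_ : _ = \sum_(i <- A) normc (x i) ^+ 2); last first.
  by apply: eq_fbigl => i; rewrite !inE /=; case: (i \in A); rewrite ?andbF.
suff <- : \sum_(i <- B) normc (if i \in A then 0 else x i) ^+ 2 =
    \sum_(i <- [fset i in (A `|` B)%fset | i \notin A]%fset) normc (x i) ^+ 2.
  by lra.
rewrite (big_fsetID _ (mem A)) /= big_seq big1 ?add0r => [|i]; last first.
  by rewrite !inE /= => /andP[_ ->]; rewrite normc0 expr0n.
rewrite (_ : [fset i in (A `|` B)%fset | i \notin A]%fset = [fset x in B | x \notin A]%fset).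
  by rewrite big_seq [RHS]big_seq; apply: eq_bigr => i; rewrite !inE /= => /andP[_ /negPf->].
by apply/fsetP => i; rewrite !inE /=; case: (i \in A); rewrite ?andbF ?andbT.
Qed.

Lemma bounded_op_nonzero (T : H -> H) : bounded_operator T -> T <> 0 ->
  exists p, T (l2_delta R p) <> 0.
Proof.
move=> [lT bT] T0; apply: contrapT => nT; apply: T0; apply/funext => x.
have Td p : T (l2_delta R p) = 0 by apply: contrapT => h; apply: nT; exists p.
have [M M0 TM] := opbound_nonneg bT.
apply: l2_norm_small_eq0 => e e0.
have N0 : 0 < M + 1 by rewrite ltr_wpDl.
have [A hA] := l2_finite_support_dense x (divr_gt0 e0 N0).
set y := \sum_(p <- A) _ in hA.
have Ty : T y = 0.
  rewrite /y; elim: (A : seq I) => [|p s IH]; first by rewrite big_nil linear_op0.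
  by rewrite big_cons lT Td scaler0 add0r IH.
rewrite -(subr0 (T x)) -Ty -(linear_opB _ _ lT); apply: le_trans (TM _) _.
apply: le_trans (ler_wpM2l M0 hA) _.
by rewrite mulrCA ger_pMr// ler_pdivrMr// mul1r lerDl.
Qed.

Lemma opbound_pointwise (T : H -> H) (M : R) : 0 <= M ->
  (forall x i, normc (T x i) <= M * normc (x i)) -> opbound T M.
Proof.
move=> M0 TM x; apply: l2_norm_le => [|A]; first by rewrite mulr_ge0 ?l2_norm_ge0.
apply: (@le_trans _ _ (\sum_(i <- A) M ^+ 2 * normc (x i) ^+ 2)).
  apply: ler_sum => i _; rewrite -exprMn lerXn2r ?nnegrE ?mulr_ge0 ?normc_ge0//.
by rewrite -mulr_sumr exprMn ler_wpM2l ?sqr_ge0// l2_norm_ge.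
Qed.

Lemma has_sum_bij (f : I -> R[i]) (s : R[i]) (t t' : I -> I) :
  cancel t t' -> cancel t' t -> has_sum f s -> has_sum (f \o t) s.
Proof.
move=> tK t'K fs e e0; have [A fA] := fs e e0.
exists [fset t' i | i in A]%fset => B /fsubsetP AB.
rewrite (_ : \sum_(i <- B) (f \o t) i = \sum_(i <- [fset t i | i in B]%fset) f i).
  apply: fA; apply/fsubsetP => i iA; apply/imfsetP; exists (t' i); last by rewrite t'K.
  by apply: AB; apply/imfsetP; exists i.
by rewrite big_imfset//= => i j _ _; exact: (can_inj tK).
Qed.

End Density.

(** * The algebraic crossed product *)

Section CrossedProduct.
Variables (R : realType) (G : groupType) (X : topologicalType).
Variable act : G -> X -> X.
Hypotheses (cX : compact [set: X]) (contact : continuous_action act).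
Local Notation H := (l2 R (G * X)%type).
Local Notation cfun := (X -> R[i]^o).
Local Notation alg := (algebraic_crossed_product (R := R) act).
Local Notation cf := (crossed_fun (R := R) act).
Local Notation cu := (crossed_unitary (R := R) (X := X)).
Implicit Types (f g : cfun) (xi eta : H) (T S : H -> H) (s t : G).

Lemma continuous_normc f : continuous f -> continuous (fun x => normc (f x)).
Proof.
move=> cf x; apply/cvgrPdist_lt => e e0.
have e0' : 0 < e%:C%C by rewrite ltcR.
have /cvgrPdist_lt /(_ _ e0') := cf x.
apply: filterS => y; rewrite -[X in X < _ -> _]/((normc (f x - f y))%:C%C) ltcR => fxy.
apply: le_lt_trans fxy; exact: (ler_dist_dist (f x : Rcomplex R) (f y)).
Qed.

Lemma continuous_normc_bound f : continuous f ->
  exists2 M : R, 0 <= M & forall x, normc (f x) <= M.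
Proof.
move=> /continuous_normc cnf.
have [M [_ fM]] : bounded_set (range (fun x => normc (f x))).
  apply: compact_bounded; apply: continuous_compact cX.
  exact: continuous_subspaceT.
exists `|M + 1| => // x; apply: le_trans (ler_norm (M + 1)).
apply: le_trans (ler_norm _) _; apply: (fM (M + 1)); first by rewrite ltrDl.
by exists x.
Qed.

Lemma cst_cfun (c : R[i]) : continuous ((fun=> c) : cfun).
Proof. exact: cst_continuous. Qed.

Lemma addc_continuous f g : continuous f -> continuous g ->
  continuous (fun x => f x + g x : R[i]^o).
Proof. by move=> cf cg x; apply: cvgD; [exact: cf|exact: cg]. Qed.

Lemma mulc_continuous f g : continuous f -> continuous g ->
  continuous (fun x => (f x : R[i]) * g x : R[i]^o).
Proof. by move=> cf cg x; apply: cvgM; [exact: cf|exact: cg]. Qed.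

Lemma conjc_continuous f : continuous f -> continuous (fun x => (f x)^*%C : R[i]^o).
Proof.
move=> cf x; apply/cvgrPdist_lt => e e0.
have /cvgrPdist_lt /(_ _ e0) := cf x; apply: filterS => y.
by rewrite -rmorphB normcJ.
Qed.

Lemma translate_continuous f t : continuous f -> continuous (f \o act t).
Proof.
move=> cf x; apply: (@continuous_comp _ _ _ (act t) f); last exact: cf.
exact: action_continuous.
Qed.

Lemma crossed_fun_bound f (M : R) : 0 <= M -> continuous f ->
  (forall x, normc (f x) <= M) -> opbound (cf f) M.
Proof.
move=> M0 cf' fM; apply: opbound_pointwise => // xi p.
by rewrite crossed_funE// normcM ler_wpM2r ?normc_ge0.
Qed.

Lemma bounded_crossed_fun f : continuous f -> bounded_operator (cf f).
Proof.
move=> cf'; have [M M0 fM] := continuous_normc_bound cf'; split.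
  move=> c x y; apply: l2_ext => p.
  by rewrite l2D l2Z !crossed_funE// l2D l2Z mulrDr mulrCA.
by exists M; exact: crossed_fun_bound.
Qed.

Lemma crossed_unitary_bound t : opbound (cu t) 1.
Proof.
move=> xi; rewrite mul1r; apply: l2_norm_le => [|A]; first exact: l2_norm_ge0.
under eq_bigr do rewrite crossed_unitaryE.
apply: le_trans (l2_norm_ge xi [fset ((t^-1 * p.1)%g, p.2) | p in A]%fset).
rewrite big_imfset//= => -[g x] [h y] _ _ [/mulgI -> ->].
by [].
Qed.

Lemma bounded_crossed_unitary t : bounded_operator (cu t).
Proof.
split; last by exists 1; exact: crossed_unitary_bound.
by move=> c x y; apply: l2_ext => p; rewrite l2D l2Z !crossed_unitaryE.
Qed.

Lemma crossed_fun_adjoint f : continuous f ->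
  is_adjoint (cf f) (cf (fun x => (f x)^*%C)).
Proof.
move=> cf' x y; apply: has_sum_unique (dot_has_sum _ _) _.
have := dot_has_sum x (cf (fun x => (f x)^*%C) y).
congr has_sum; apply/funext => p; rewrite !crossed_funE//; last exact: conjc_continuous.
by rewrite conjcM conjcK mulrCA mulrA.
Qed.

Lemma crossed_unitary_adjoint t : is_adjoint (cu t) (cu t^-1%g).
Proof.
move=> x y; apply: has_sum_unique (dot_has_sum _ _) _.
pose u (p : G * X) := ((t^-1 * p.1)%g, p.2); pose u' (p : G * X) := ((t * p.1)%g, p.2).
have uK : cancel u u' by move=> [g z]; rewrite /u' /= mulVKg.
have u'K : cancel u' u by move=> [g z]; rewrite /u /= mulKg.
have := has_sum_bij uK u'K (dot_has_sum x (cu t^-1%g y)).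
congr has_sum; apply/funext => p; rewrite /= !crossed_unitaryE /= invgK mulVKg.
by case: p.
Qed.

Definition term (p : G * cfun) : H -> H := cf p.2 \o cu p.1.

Lemma bounded_term p : continuous p.2 -> bounded_operator (term p).
Proof.
move=> cp; apply: bounded_op_comp; first exact: bounded_crossed_fun.
exact: bounded_crossed_unitary.
Qed.

Lemma termE p xi q : continuous p.2 ->
  term p xi q = (p.2 (act q.1 q.2) : R[i]) * xi ((p.1^-1 * q.1)%g, q.2).
Proof. by move=> cp; rewrite /term /= crossed_funE// crossed_unitaryE. Qed.

(** A sum of terms over distinct group elements, which isolates the
    coefficient of the identity. *)
Definition reduced_sum T := exists (F : seq G) (f : G -> cfun),
  [/\ uniq F, forall t, continuous (f t) & T = \sum_(t <- F) term (t, f t)].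

Lemma reduced_sum_add t f0 T : continuous f0 -> reduced_sum T ->
  reduced_sum (term (t, f0) + T).
Proof.
move=> cf0 [F [f [uF cf' ->]]]; case: (boolP (t \in F)) => tF.
  exists F, (fun s => if s == t then fun x => f s x + f0 x else f s).
  split; first exact: uF.
    by move=> s; case: (s =P t) => _; [exact: (addc_continuous (cf' s) cf0)|exact: cf'].
  rewrite (bigD1_seq t)//= [RHS](bigD1_seq t)//= eqxx addrA; congr (_ + _).
    apply/funext => xi; apply: l2_ext => q.
    rewrite (termE (p := (t, fun x => f t x + f0 x))); last exact: (addc_continuous (cf' t) cf0).
    transitivity (term (t, f0) xi q + term (t, f t) xi q : R[i]); first by [].
    by rewrite (@termE (t, f0) xi q cf0) (@termE (t, f t) xi q (cf' t)) /= mulrDl addrC.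
  by apply: eq_bigr => s /negPf->.
exists (t :: F), (fun s => if s == t then f0 else f s); split.
- by rewrite /= tF.
- by move=> s; case: (s =P t) => _; [exact: cf0|exact: cf'].
rewrite big_cons eqxx; congr (_ + _); apply: eq_big_seq => s sF.
by case: eqP => // st; rewrite -st sF in tF.
Qed.

Lemma reduced_sum_algebraic T : reduced_sum T -> alg T.
Proof. by move=> [F [f [_ cf' ->]]]; exists F, f. Qed.

Lemma terms_ind (P : (H -> H) -> Prop) T : P 0 ->
  (forall t f S, continuous f -> P S -> P (term (t, f) + S)) -> alg T -> P T.
Proof.
move=> P0 PD [F [f [cf' ->]]]; elim: F => [|t F IH]; first by rewrite big_nil.
by rewrite big_cons; apply: PD => //; exact: cf'.
Qed.

Lemma algebraic_reduced_sum T : alg T -> reduced_sum T.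
Proof.
apply: terms_ind => [|t f S cf' SS]; last exact: reduced_sum_add.
by exists [::], (fun _ _ => 0); split=> [//|t|]; [exact: cst_cfun|rewrite big_nil].
Qed.

Lemma algebraic_add_term t f T : continuous f -> alg T -> alg (term (t, f) + T).
Proof.
move=> cf' /algebraic_reduced_sum h.
exact/reduced_sum_algebraic/reduced_sum_add.
Qed.

Lemma algebraic_crossed0 : alg 0.
Proof.
by exists [::], (fun _ _ => 0); split=> [t|]; [exact: cst_cfun|rewrite big_nil].
Qed.

Lemma algebraic_term t f : continuous f -> alg (term (t, f)).
Proof.
move=> cf'; rewrite -[term _]addr0; apply: algebraic_add_term => //.
exact: algebraic_crossed0.
Qed.

Lemma algebraicD S T : alg S -> alg T -> alg (S + T).
Proof.
move=> + algT; apply: (@terms_ind (fun S => alg (S + T))) => [|t f S' cf' IH].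
  by rewrite add0r.
by rewrite -addrA; exact: algebraic_add_term.
Qed.

Lemma crossed_fun_term f : continuous f -> cf f = term (1%g, f).
Proof.
move=> cf'; apply/funext => xi; apply: l2_ext => -[g x].
by rewrite termE// crossed_funE//= invg1 mul1g.
Qed.

Lemma crossed_unitary_term t : cu t = term (t, fun=> 1).
Proof.
apply/funext => xi; apply: l2_ext => q.
by rewrite termE ?crossed_unitaryE ?mul1r//; exact: cst_cfun.
Qed.

Lemma id_term : id = term (1%g, fun=> 1).
Proof.
apply/funext => xi; apply: l2_ext => -[g x].
by rewrite termE ?mul1r /= ?invg1 ?mul1g//; exact: cst_cfun.
Qed.

(** This is u_s g = (s.g) u_s. *)
Lemma term_mul s t f g : continuous f -> continuous g ->
  term (s, f) \o term (t, g) =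
  term ((s * t)%g, fun x => (f x : R[i]) * g (act s^-1%g x)).
Proof.
move=> cf' cg; apply/funext => xi; apply: l2_ext => -[h x].
have cfg := mulc_continuous cf' (@translate_continuous g s^-1%g cg).
rewrite (@termE ((s * t)%g, fun x => (f x : R[i]) * (g \o act s^-1%g) x) xi (h, x) cfg).
transitivity (f (act h x) * term (t, g) xi ((s^-1 * h)%g, x) : R[i]).
  exact: (@termE (s, f) (term (t, g) xi) (h, x) cf').
rewrite (@termE (t, g) xi ((s^-1 * h)%g, x) cg) /=.
by rewrite invgM (actionM contact) !mulgA mulrA.
Qed.

Lemma algebraic_bounded T : alg T -> bounded_operator T.
Proof.
apply: terms_ind => [|t f S cf' bS]; first exact: bounded_op0.
by apply: bounded_opD => //; exact: bounded_term.
Qed.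

Lemma algebraicM S T : alg S -> alg T -> alg (S \o T).
Proof.
move=> + algT; apply: (@terms_ind (fun S => alg (S \o T))) => [|t f S' cf' IH].
  rewrite (_ : _ \o _ = 0); first exact: algebraic_crossed0.
  by apply/funext.
rewrite (_ : _ \o _ = (term (t, f) \o T) + (S' \o T)); last by apply/funext.
apply: algebraicD IH.
apply: (@terms_ind (fun T => alg (term (t, f) \o T))) algT => [|s g T' cg IH].
  rewrite (_ : _ \o _ = 0); first exact: algebraic_crossed0.
  apply/funext => x /=; rewrite (linear_op0 (@bounded_term (t, f) cf').1) //.
rewrite (_ : _ \o _ = (term (t, f) \o term (s, g)) + (term (t, f) \o T')).
  apply: algebraicD IH; rewrite (term_mul _ _ cf' cg); apply: algebraic_term.
  exact: (mulc_continuous cf' (@translate_continuous g t^-1%g cg)).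
apply/funext => x.
exact: (linear_opD _ _ (@bounded_term (t, f) cf').1).
Qed.

Lemma algebraic_crossed_algebra : operator_algebra alg.
Proof.
split.
- exact: algebraic_bounded.
- by rewrite id_term; apply: algebraic_term; exact: cst_cfun.
- exact: algebraicD.
- move=> c T algT.
  rewrite (_ : c *: T = cf (fun=> c) \o T).
    by apply: algebraicM => //; rewrite crossed_fun_term; [apply: algebraic_term|]; exact: cst_cfun.
  apply/funext => x; apply: l2_ext => q.
  by rewrite opZE l2Z /= crossed_funE//; exact: cst_cfun.
- exact: algebraicM.
Qed.

Lemma algebraic_crossed_fun f : continuous f -> alg (cf f).
Proof. by move=> cf'; rewrite crossed_fun_term//; exact: algebraic_term. Qed.

Lemma algebraic_crossed_unitary t : alg (cu t).
Proof. by rewrite crossed_unitary_term; apply: algebraic_term; exact: cst_cfun. Qed.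

Lemma algebraic_adjoint T : alg T -> exists2 T', alg T' & is_adjoint T T'.
Proof.
apply: (@terms_ind (fun T => exists2 T', alg T' & is_adjoint T T'))
  => [|t f S cf' [S' algS' SS']].
  by exists 0; [exact: algebraic_crossed0|exact: adjoint0].
exists ((cu t^-1%g \o cf (fun x => (f x)^*%C)) + S').
  apply: algebraicD => //; apply: algebraicM; first exact: algebraic_crossed_unitary.
  by apply: algebraic_crossed_fun; exact: conjc_continuous.
apply: adjointD => //; apply: adjoint_comp; first exact: crossed_fun_adjoint.
exact: crossed_unitary_adjoint.
Qed.

End CrossedProduct.

(** * Compression by an isometry *)

Section CompressingIsometry.
Variables (R : realType) (G : groupType) (X : topologicalType).
Variable act : G -> X -> X.
Hypotheses (cX : compact [set: X]) (contact : continuous_action act).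
Variables (E : {fset G}) (h : X -> G).
Hypotheses (hE : forall x, h x \in E) (hopen : forall e, open (h @^-1` [set e])).
Hypothesis hinj : injective (fun x => act (h x) x).
Local Notation H := (l2 R (G * X)%type).
Local Notation cfun := (X -> R[i]^o).
Local Notation alg := (algebraic_crossed_product (R := R) act).
Local Notation cf := (crossed_fun (R := R) act).
Local Notation cu := (crossed_unitary (R := R) (X := X)).

Definition level (e : G) : cfun := fun x => (h x == e)%:R.

Lemma level_continuous e : continuous (level e).
Proof.
move=> x A Ax; have hx : nbhs x (h @^-1` [set h x]).
  by apply: open_nbhs_nbhs; split; [exact: hopen|].
apply: filterS hx => y /= hy; move/nbhs_singleton: Ax.
by rewrite /= /level hy.
Qed.

(** The isometry v = sum of u_e 1_(h = e). It sends the basis vector (s, y) to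
    (h (s y) s, y), which is injective because the translated pieces are
    disjoint. *)
Definition spread : H -> H := \sum_(e <- E) (cu e \o cf (level e)).

(** The adjoint of spread; as is_adjoint is only a relation, the adjoint needs
    a formula of its own. *)
Definition gather : H -> H := \sum_(e <- E) (cf (level e) \o cu e^-1%g).

Lemma gather_summand e xi s x : (cf (level e) \o cu e^-1%g) xi (s, x) =
  (h (act s x) == e)%:R * (xi ((e * s)%g, x) : R[i]).
Proof.
transitivity ((level e (act s x) : R[i]) * cu e^-1%g xi (s, x)).
  exact: (@crossed_funE R G X act (level e) (cu e^-1%g xi) (s, x) cX (@level_continuous e)).
by rewrite crossed_unitaryE /= invgK.
Qed.

Lemma spread_summand e xi s x : (cu e \o cf (level e)) xi (s, x) =
  (h (act (e^-1 * s)%g x) == e)%:R * (xi ((e^-1 * s)%g, x) : R[i]).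
Proof.
transitivity (cf (level e) xi ((e^-1 * s)%g, x)); first exact: crossed_unitaryE.
exact: (@crossed_funE R G X act (level e) xi ((e^-1 * s)%g, x) cX (@level_continuous e)).
Qed.

Lemma gatherE xi s x : gather xi (s, x) = xi ((h (act s x) * s)%g, x).
Proof.
rewrite /gather op_sum_apply l2_sum_apply.
rewrite (eq_bigr _ (fun e _ => gather_summand e xi s x)).
rewrite (big_fsetD1 (h (act s x)) (hE _)) /= eqxx mul1r big_seq big1 ?addr0// => e.
by rewrite in_fsetD1 eq_sym => /andP[/negPf-> _]; rewrite mul0r.
Qed.

Lemma spreadE xi s x : spread xi (s, x) =
  \sum_(e <- E) (h (act (e^-1 * s)%g x) == e)%:R * (xi ((e^-1 * s)%g, x) : R[i]).
Proof.
rewrite /spread op_sum_apply l2_sum_apply.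
exact: (eq_bigr _ (fun e _ => spread_summand e xi s x)).
Qed.

Lemma spread_adjoint : is_adjoint spread gather.
Proof.
rewrite /spread /gather; elim: (E : seq G) => [|e F IH].
  by rewrite !big_nil; exact: adjoint0.
rewrite !big_cons; apply: adjointD IH; apply: adjoint_comp.
  exact: crossed_unitary_adjoint.
move=> x y; rewrite (crossed_fun_adjoint act cX (@level_continuous e)).
congr (l2_dot x (cf _ y)); apply/funext => z.
by rewrite /level; case: (_ == _); rewrite ?conjc1 ?conjc0.
Qed.

Lemma spread_algebraic : alg spread.
Proof.
have algA := @algebraic_crossed_algebra R _ _ _ cX contact.
rewrite /spread; elim: (E : seq G) => [|e F IH].
  by rewrite big_nil; exact: algebraic_crossed0.
rewrite big_cons; apply: (opalgD algA) IH; apply: (opalgM algA).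
  exact: algebraic_crossed_unitary.
exact: (algebraic_crossed_fun act cX (@level_continuous e)).
Qed.

Lemma gather_algebraic : alg gather.
Proof.
have algA := @algebraic_crossed_algebra R _ _ _ cX contact.
rewrite /gather; elim: (E : seq G) => [|e F IH].
  by rewrite big_nil; exact: algebraic_crossed0.
rewrite big_cons; apply: (opalgD algA) IH; apply: (opalgM algA).
  exact: (algebraic_crossed_fun act cX (@level_continuous e)).
exact: algebraic_crossed_unitary.
Qed.

(** The isometry moves everything over the translated pieces. A term with
    t <> 1 moves them off themselves; the identity term is the multiplication by
    f carried back to X. *)
Lemma compress_term t (f : cfun) xi s x : continuous f ->
  (t <> 1%g -> forall y z, act (h y) y <> act t (act (h z) z)) ->
  gather (term act (t, f) (spread xi)) (s, x) =
  (if t == 1%g then f (act (h (act s x)) (act s x)) * xi (s, x) else 0 : R[i]).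
Proof.
move=> cf' disj; set y := act s x.
rewrite gatherE -/y (@termE R G X act cX (t, f) (spread xi) _ cf') /= (actionM contact) -/y spreadE.
(* In the piece e, the point contributing to the coefficient is determined by
   its image under e, which is t^-1 (h y y). *)
have key e : h (act (e^-1 * (t^-1 * (h y * s)))%g x) = e ->
    act (h y) y = act t (act e (act (e^-1 * (t^-1 * (h y * s)))%g x)).
  by move=> _; rewrite -(actionM contact e) mulVKg -(actionM contact t) mulVKg (actionM contact).
have [t1|t1] := eqVneq t 1%g; last first.
  rewrite big1 ?mulr0// => e _; case: eqP => [he|_]; last by rewrite mul0r.
  case: (disj (elimN eqP t1) y (act (e^-1 * (t^-1 * (h y * s)))%g x)).
  by rewrite he; exact: key.
rewrite t1 in key *; rewrite invg1 mul1g in key *; congr (_ * _).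
rewrite (big_fsetD1 (h y))//= mulKg -/y eqxx mul1r big_seq big1 ?addr0// => e.
rewrite in_fsetD1 => /andP[/eqP ehy _]; case: eqP => [he|_]; last by rewrite mul0r.
case: ehy; rewrite -[LHS]he; congr h; apply: hinj.
by rewrite /= he (key _ he) (action1 contact).
Qed.

Lemma gather_spread : gather \o spread = id.
Proof.
apply/funext => xi; apply: l2_ext => -[s x].
have := @compress_term 1%g (fun=> 1) xi s x (@cst_cfun R X 1).
rewrite eqxx mul1r => <-//.
by rewrite -(id_term R act cX).
Qed.

Lemma spread_bound : opbound spread 1.
Proof.
move=> xi; rewrite mul1r -(@ler_pXn2r _ 2) ?nnegrE ?l2_norm_ge0//.
rewrite -lecR -!dot_self spread_adjoint.
by rewrite -[gather (spread xi)]/((gather \o spread) xi) gather_spread.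
Qed.

(** |v^* xi|^2 = <v v^* xi, xi> is at most |v^* xi| |xi|. *)
Lemma gather_bound : opbound gather 1.
Proof.
move=> xi; rewrite mul1r.
have := dot_cauchy_schwarz (spread (gather xi)) xi.
rewrite spread_adjoint dot_self /= expr0n addr0 sqrtr_sqr ger0_norm ?sqr_ge0//.
have := spread_bound (gather xi); rewrite mul1r => h1 h2.
have [->|n0] := eqVneq (l2_norm (gather xi)) 0; first exact: l2_norm_ge0.
have np : 0 < l2_norm (gather xi) by rewrite lt_neqAle eq_sym n0 l2_norm_ge0.
rewrite -(ler_pM2l np) -expr2; apply: le_trans h2 _.
by rewrite ler_wpM2r ?l2_norm_ge0.
Qed.

Lemma compress_sum (F : seq G) (f : G -> cfun) (c : R[i]) (e : R) : 0 <= e ->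
  uniq F -> (forall t, continuous (f t)) ->
  (forall t, t \in F -> t <> 1%g -> forall y z, act (h y) y <> act t (act (h z) z)) ->
  (forall y, normc ((if 1%g \in F then f 1%g (act (h y) y) else 0) - c) <= e) ->
  opbound ((gather \o (\sum_(t <- F) term act (t, f t)) \o spread) - c *: id) e.
Proof.
move=> e0 uF cf' disj near; apply: opbound_pointwise => // xi [s x].
set y := act s x.
have lin : linear gather.
  have [] // := opalg_bounded (@algebraic_crossed_algebra R _ _ _ cX contact) gather_algebraic.
have -> : ((gather \o (\sum_(t <- F) term act (t, f t)) \o spread) - c *: id) xi (s, x) =
    ((if 1%g \in F then f 1%g (act (h y) y) else 0) - c) * xi (s, x) :> R[i].
  transitivity (gather ((\sum_(t <- F) term act (t, f t)) (spread xi)) (s, x)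
    - c * xi (s, x) : R[i]); first by [].
  rewrite mulrBl; congr (_ - _); rewrite op_sum_apply.
  transitivity (\sum_(t <- F) (gather (term act (t, f t) (spread xi)) (s, x) : R[i])).
    elim: (F) => [|t F' IH]; first by rewrite !big_nil (linear_op0 lin).
    by rewrite !big_cons (linear_opD _ _ lin) l2D IH.
  transitivity (\sum_(t <- F)
     (if t == 1%g then f t (act (h y) y) * xi (s, x) else 0 : R[i])).
    apply: eq_big_seq => t tF; apply: compress_term; [exact: cf'|exact: disj].
  case: ifPn => F1.
    rewrite (bigD1_seq 1%g)//= eqxx big1 ?addr0// => t /negPf->//.
  rewrite mul0r big_seq big1// => t tF; case: eqP => // t1.
  by rewrite -t1 tF in F1.
by rewrite normcM ler_wpM2r ?normc_ge0.
Qed.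

End CompressingIsometry.

(** * Pure infiniteness of the reduced crossed product *)

Section PureInfiniteness.
Variables (R : realType) (G : groupType) (X : topologicalType).
Variable act : G -> X -> X.
Hypotheses (namen : ~ amenable R G) (univ : universal_minimal_action act).
Let mca := univ.1.
Let contact := mca_action mca.
Let cX := mca_compact mca.
Let hX := mca_hausdorff mca.
Local Notation H := (l2 R (G * X)%type).
Local Notation alg := (algebraic_crossed_product (R := R) act).
Local Notation red := (reduced_crossed_product (R := R) act).
Let algA : operator_algebra alg := @algebraic_crossed_algebra R _ _ _ cX contact.
Let redA : operator_algebra red := norm_closure_algebra algA.

(** Freeness and separation move a neighbourhood of y0 off itself by t. *)
Lemma displaced_neighbourhood (F : seq G) (y0 : X) : exists U : set X,
  [/\ open U, U y0 &
    forall t, t \in F -> t <> 1%g -> forall x z, U x -> U z -> x <> act t z].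
Proof.
elim: F => [|t F [U [oU Uy0 UF]]]; first by exists setT; split=> //; exact: openT.
have [t1|t1] := pselect (t = 1%g).
  by exists U; split=> // s; rewrite inE => /predU1P[->//|]; exact: UF.
have neq : y0 != act t y0.
  by apply/eqP => e; apply: (universal_action_free univ (x := y0) t1).
have := hX; rewrite open_hausdorff => /(_ _ _ neq)[[A B] /= [Ay By] [oA oB AB]].
exists (U `&` (A `&` act t @^-1` B)); split.
- apply: openI => //; apply: openI => //; apply: open_comp oB => x _.
  exact: action_continuous.
- by split=> //; split; [exact: set_mem Ay|exact: set_mem By].
move=> s; rewrite inE => /predU1P[-> _|sF s1] x z [Ux [Ax _]] [Uz [_ Bz]]; last exact: UF.
move=> xz; have : (A `&` B) x by split=> //; rewrite xz.
by rewrite (eqP AB).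
Qed.

Lemma term_delta t (f : X -> R[i]^o) s y : continuous f ->
  term act (t, f) (l2_delta R (s, y)) (s, y) =
  (if t == 1%g then f (act s y) else 0 : R[i]).
Proof.
move=> cf; rewrite (@termE R G X act cX (t, f) _ _ cf) /= l2_deltaE xpair_eqE eqxx andbT.
rewrite (_ : (_ == s) = (t == 1%g)); first by case: eqP; rewrite ?mulr1 ?mulr0.
apply/eqP/eqP => [e|->]; last by rewrite invg1 mul1g.
by apply: invg_inj; rewrite invg1; apply: (mulIg s); rewrite mul1g.
Qed.

(** The scalar is the value at s y of the conditional expectation of a, up to
    e / 3 that of the coefficient at 1 of the approximation a0, a continuous
    function which is almost constant on the open set that receives X. *)
Lemma compression (a : H -> H) (p : G * X) (e : R) : red a -> 0 < e ->
  exists v vs : H -> H, [/\ alg v, alg vs, is_adjoint v vs &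
    opbound ((vs \o a \o v) - l2_dot (a (l2_delta R p)) (l2_delta R p) *: id) e].
Proof.
case: p => s y ra e0; set dp := l2_delta R (s, y); set c : R[i] := l2_dot _ _.
have e30 : 0 < e / 3 by rewrite divr_gt0.
have [a0 alga0 aa0] := norm_closure_approx (opalg_bounded algA) ra e30.
have [F [f [uF cf a0E]]] := algebraic_reduced_sum cX alga0.
pose g : X -> R[i]^o := if 1%g \in F then f 1%g else fun=> 0.
have cg : continuous g by rewrite /g; case: ifP => _; [exact: cf|exact: cst_continuous].
pose y0 := act s y.
have cE : normc (c - g y0) <= e / 3.
  have -> : (g y0 : R[i]) = l2_dot (a0 dp) dp.
    rewrite dot_delta a0E op_sum_apply l2_sum_apply.
    rewrite (eq_bigr (fun t => if t == 1%g then f t y0 else 0 : R[i])); last first.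
      by move=> t _; exact: (term_delta t s y (cf t)).
    rewrite /g; case: ifPn => F1.
      by rewrite (bigD1_seq 1%g)//= eqxx big1 ?addr0// => t /negPf->.
    by rewrite big_seq big1// => t tF; case: eqP => // t1; rewrite -t1 tF in F1.
  rewrite -dotBl -opBE; apply: le_trans (dot_cauchy_schwarz _ _) _.
  by have := aa0 dp; rewrite !l2_norm_delta !mulr1.
have [U0 [oU0 U0y UF]] := displaced_neighbourhood F y0.
pose V := [set x | normc (g x - g y0) < e / 3].
have Vy0 : nbhs y0 V.
  have e30' : 0 < (e / 3)%:C%C by rewrite ltcR.
  have /cvgrPdist_lt /(_ _ e30') := cg y0; apply: filterS => x.
  by rewrite -normrN opprB -[X in X < _ -> _]/((normc (g x - g y0))%:C%C) ltcR.
have [] := @universal_comparison G X act univ R (U0 `&` V^°) namen.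
- by apply: openI => //; exact: open_interior.
- by exists y0; split=> //; exact: Vy0.
move=> E [h [hE hopen hU hinj]].
have disj t : t \in F -> t <> 1%g -> forall x z, act (h x) x <> act t (act (h z) z).
  by move=> tF t1 x z; apply: (UF t tF t1); [exact: (hU x).1|exact: (hU z).1].
exists (spread act E h), (gather act E h); split.
- exact: spread_algebraic.
- exact: gather_algebraic.
- exact: spread_adjoint.
have galg : alg (gather act E h) by exact: gather_algebraic.
have [lg bg] := opalg_bounded algA galg.
have near x : normc ((if 1%g \in F then f 1%g (act (h x) x) else 0) - g y0) <= e / 3.
  rewrite (_ : (if _ then _ else _) = g (act (h x) x)); last by rewrite /g; case: ifP.
  by apply/ltW; exact: (interior_subset (hU x).2).
have hsum := compress_sum cX contact hE hopen hinj (ltW e30) uF cf disj near.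
rewrite -a0E in hsum.
set v := spread act E h in hsum *; set vs := gather act E h in lg bg hsum *.
have v1 : opbound v 1 by exact: spread_bound.
have vs1 : opbound vs 1 by exact: gather_bound.
(* The errors come from a - a0, from the oscillation of g on U, and from
   c - g y0. *)
have -> : (vs \o a \o v) - c *: id =
    (vs \o (a - a0) \o v) + ((vs \o a0 \o v) - (g y0 : R[i]) *: id) + ((g y0 : R[i]) - c) *: id.
  apply/funext => x; rewrite scalerBl !(opDE, opBE, opNE, opZE) /= opBE (linear_opB _ _ lg).
  by apply: l2_ext => i; rewrite !(l2D, l2N, l2Z); ring.
have h1 : opbound (vs \o (a - a0) \o v) (e / 3).
  have := opbound_comp _ (opbound_comp _ vs1 aa0) v1; rewrite mul1r mulr1; apply => //.
  exact: ltW.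
have h3 : opbound (((g y0 : R[i]) - c) *: (id : H -> H)) (e / 3).
  have id1 : opbound (id : H -> H) 1 by move=> x; rewrite mul1r.
  have := opboundZ ((g y0 : R[i]) - c) id1; apply: opbound_le.
  by rewrite mulr1 -normcN opprB.
apply: opbound_le (opboundD (opboundD h1 hsum) h3); lra.
Qed.

(** With a = b^* b and r = |b delta|^2 > 0, the compression v^* a v / r is
    1 - d with |d| <= 1/8, and x = r^(-1/2) y v^* with y (1 - d) y = 1. *)
Lemma reduced_positive_inverse (a : H -> H) : positive_element red a -> a <> 0 ->
  exists x xstar, [/\ red x, red xstar, is_adjoint x xstar & x \o a \o xstar = id].
Proof.
move=> [b [bs [rb rbs bbs aE]]] a0.
have bnd T : red T -> bounded_operator T by move=> rT; exact: (opalg_bounded redA rT).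
have b0 : b <> 0.
  move=> b0; apply: a0; rewrite aE b0; apply/funext => x.
  exact: (linear_op0 (bnd _ rbs).1).
have [p bp] := bounded_op_nonzero (bnd _ rb) b0.
set dp := l2_delta R p in bp.
have n0 : 0 < l2_norm (b dp).
  by rewrite lt_neqAle l2_norm_ge0 andbT eq_sym; apply/eqP => /l2_norm0_eq.
pose r := l2_norm (b dp) ^+ 2; have r0 : 0 < r by rewrite exprn_gt0.
have ra : red a by rewrite aE; exact: (opalgM redA).
have aa : is_adjoint a a by rewrite aE; exact: (adjoint_comp (adjoint_sym bbs) bbs).
have cE : l2_dot (a dp) dp = r%:C%C.
  by rewrite aE -[(bs \o b) dp]/(bs (b dp)) (adjoint_sym bbs) dot_self.
have [v [vs [algv algvs vvs]]] := compression p ra (divr_gt0 r0 (ltr0Sn R 7)).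
rewrite -/dp cE; set T := vs \o a \o v => hT.
have rv := norm_closure_sub algA algv; have rvs := norm_closure_sub algA algvs.
have rT : red T by exact: (opalgM redA (opalgM redA rvs ra) rv).
have TT : is_adjoint T T.
  exact: (adjoint_comp (adjoint_comp (adjoint_sym vvs) aa) vvs).
pose c1 : R[i] := (r^-1)%:C%C.
have c1c : c1 * r%:C%C = 1 by rewrite -rmorphM mulVf ?gt_eqF.
have nc1 : normc c1 = r^-1 by rewrite /= expr0n addr0 sqrtr_sqr ger0_norm// invr_ge0 ltW.
pose d : H -> H := id - c1 *: T.
have rN S : red S -> red (- S) by move=> rS; rewrite -scaleN1r; exact: (opalgZ redA).
have rd : red d.
  exact: (opalgD redA (opalg_id redA) (rN _ (opalgZ redA c1 rT))).
have dd : is_adjoint d d.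
  apply: adjointD; first exact: adjoint_id.
  by apply: adjointN; have := adjointZ c1 TT; rewrite [c1^*%C]conjc_real.
have d8 : opbound d (1 / 8).
  have -> : d = - (c1 *: (T - r%:C%C *: id)) by rewrite scalerBr scalerA c1c scale1r opprB.
  have := opboundN (opboundZ c1 hT); apply: opbound_le.
  by rewrite nc1 mulrA mulVf ?gt_eqF.
have [y [ry yy yE]] := inverse_square_root redA (@norm_closure_closed _ _ _ algA) rd dd d8.
pose s : R[i] := (Num.sqrt r^-1)%:C%C.
have ss : s * s = c1 by rewrite -rmorphM -expr2 sqr_sqrtr// invr_ge0 ltW.
exists (s *: (y \o vs)), (s *: (v \o y)); split.
- exact: (opalgZ redA s (opalgM redA ry rvs)).
- exact: (opalgZ redA s (opalgM redA rv ry)).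
- have := adjointZ s (adjoint_comp yy (adjoint_sym vvs)).
  by rewrite [s^*%C]conjc_real.
have [ly _] := bnd _ ry.
have [lyva _] := bnd _ (opalgM redA (opalgM redA ry rvs) ra).
apply/funext => x; have yEx : (y \o (id - d) \o y) x = x by rewrite yE.
rewrite -[RHS]yEx.
transitivity (s *: (y \o vs \o a) (s *: v (y x))); first by [].
rewrite (linear_opZ _ _ lyva) scalerA ss -[LHS]/(c1 *: y (T (y x))).
rewrite -(linear_opZ _ _ ly) -[RHS]/(y ((id - d) (y x))); congr (y _).
by rewrite /d opprB addrC subrK.
Qed.

(** The diagonal coefficients of b may all vanish, but multiplying b by the
    adjoint of an algebraic approximation b1 produces one that is close to
    |b delta|^2, to which compression applies. *)
Lemma reduced_ideal_full (J : set (H -> H)) b : closed_ideal red J -> J b -> b <> 0 ->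
  J = red.
Proof.
move=> idJ Jb b0; have rb := ideal_sub idJ Jb.
have bnd T : red T -> bounded_operator T by move=> rT; exact: (opalg_bounded redA rT).
suff Jid : J id.
  apply/seteqP; split=> [|T rT]; first exact: (ideal_sub idJ).
  exact: (idealMl idJ rT Jid).
have [p bp] := bounded_op_nonzero (bnd _ rb) b0.
set dp := l2_delta R p in bp.
have n0 : 0 < l2_norm (b dp).
  by rewrite lt_neqAle l2_norm_ge0 andbT eq_sym; apply/eqP => /l2_norm0_eq.
pose n := l2_norm (b dp).
have [b1 algb1 bb1] := norm_closure_approx (opalg_bounded algA) rb (divr_gt0 n0 (ltr0Sn R 1)).
have [b1s algb1s b1b1s] := algebraic_adjoint cX contact algb1.
pose a := b1s \o b.
have Ja : J a by exact: (idealMl idJ (norm_closure_sub algA algb1s) Jb).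
set c : R[i] := l2_dot (a dp) dp.
have cE : (n ^+ 2)%:C%C = c + l2_dot (b dp) ((b - b1) dp) :> R[i].
  rewrite -dot_self opBE dotBr /c -[a dp]/(b1s (b dp)) (adjoint_sym b1b1s); ring.
have c0 : c != 0.
  apply/eqP => c0; rewrite c0 add0r in cE.
  have := dot_cauchy_schwarz (b dp) ((b - b1) dp); rewrite -cE /= expr0n addr0.
  rewrite sqrtr_sqr ger0_norm ?sqr_ge0//; have := bb1 dp; rewrite l2_norm_delta mulr1 -/n.
  move=> h /le_trans /(_ (ler_wpM2l (ltW n0) h)); rewrite -/n; have : 0 < n by [].
  by nra.
have nc0 : 0 < normc c by rewrite normc_gt0.
have [v [vs [algv algvs _]]] := compression p (ideal_sub idJ Ja) (divr_gt0 nc0 (ltr0Sn R 1)).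
rewrite -/dp -/c; set T := vs \o a \o v => hT.
have JT : J T.
  exact: (Defs.idealMr idJ (idealMl idJ (norm_closure_sub algA algvs) Ja)
    (norm_closure_sub algA algv)).
apply: (ideal_near_id redA idJ (T := c^-1 *: T)); first exact: (idealZ idJ).
have -> : id - c^-1 *: T = - (c^-1 *: (T - c *: id)).
  by rewrite scalerBr scalerA mulVf// scale1r opprB.
have := opboundN (opboundZ c^-1 hT); apply: opbound_le.
by rewrite normcV mulrA mulVf ?gt_eqF.
Qed.

Lemma reduced_simple : simple_cstar red.
Proof.
split=> [red0|J idJ].
  have [x0 _] := mca_nonempty mca; have := opalg_id redA; rewrite red0 => id0.
  have := l2_norm_delta R (1%g, x0) : l2_norm (l2_delta R ((1%g, x0) : G * X)) = 1.
  rewrite -[l2_delta R _]/(id (l2_delta R _)) id0 l2_norm0 => /eqP.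
  by rewrite eq_sym oner_eq0.
have [[b [Jb b0]]|nb] := pselect (exists b, J b /\ b <> 0).
  by right; exact: reduced_ideal_full Jb b0.
left; apply/seteqP; split=> [b Jb|_ ->]; last exact: ideal0 idJ.
by apply: contrapT => b0; apply: nb; exists b.
Qed.

End PureInfiniteness.

Theorem corollaryA5 (R : realType) (G : groupType) (X : topologicalType)
    (act : G -> X -> X) :
  ~ amenable R G ->
  universal_minimal_action act ->
  purely_infinite (reduced_crossed_product (R := R) act).
Proof.
move=> namen univ; split; first exact: reduced_simple.
exact: reduced_positive_inverse.
Qed.
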